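(* Let $\mathcal V$ be a reduction of a tame Kuranishi atlas $\mathcal K$. Then there exists a canonical Kuranishi atlas $\mathcal K^{\mathcal V}$ which satisfies the strong cocycle condition and is equipped with a canonical faithful functor $\iota^{\mathcal V}:\mathbf B_{\mathcal K^{\mathcal V}}\to\mathbf B_{\mathcal K}$ that induces a continuous injection $|\mathcal K^{\mathcal V}|\to|\mathcal K|$ with image $\pi_{\mathcal K}(\mathcal V)$.
   Context: $X$ is a compact metrizable space (all atlases here are on $X$). A Kuranishi chart (trivial isotropy) for $X$ with footprint a nonempty open $F\subset X$ is $\mathbf K=(U,E,s,\psi)$ with $U$ a finite-dimensional smooth manifold (without boundary), $E$ a finite-dimensional real vector space, $s:U\to E$ smooth, $\psi:s^{-1}(0)\to X$ a homeomorphism onto $F$; $\dim\mathbf K=\dim U-\dim E$. A coordinate change $\widehat\Phi_{IJ}:\mathbf K_I\to\mathbf K_J$ ($F_I\cap F_J\neq\emptyset$) consists of an open $U_{IJ}\subset U_I$ with $U_{IJ}\cap s_I^{-1}(0)=\psi_I^{-1}(F_I\cap F_J)$, a smooth embedding $\phi_{IJ}:U_{IJ}\to U_J$ and a linear injection $\widehat\phi_{IJ}:E_I\to E_J$ with $s_J\circ\phi_{IJ}=\widehat\phi_{IJ}\circ s_I$, $\phi_{IJ}=\psi_J^{-1}\circ\psi_I$ on $U_{IJ}\cap s_I^{-1}(0)$, and the index condition: for all $u\in U_{IJ}$, $d_u\phi_{IJ}(\ker d_us_I)=\ker d_{\phi_{IJ}(u)}s_J$, and $E_I=\operatorname{im}d_us_I\oplus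 C$ implies $E_J=\operatorname{im}d_{\phi_{IJ}(u)}s_J\oplus\widehat\phi_{IJ}(C)$. A Kuranishi atlas $\mathcal K$ of dimension $d$ on $X$ consists of finitely many basic charts $\mathbf K_1,\dots,\mathbf K_N$ with footprints covering $X$; with $\mathcal I_{\mathcal K}=\{\emptyset\neq I\subset\{1,\dots,N\}:F_I:=\bigcap_{i\in I}F_i\neq\emptyset\}$, charts $\mathbf K_I$ with footprint $F_I$ for $I\in\mathcal I_{\mathcal K}$ ($\mathbf K_{\{i\}}=\mathbf K_i$), all of dimension $d$; and coordinate changes $\widehat\Phi_{IJ}$ for $I\subsetneq J$, such that for $I\subsetneq J\subsetneq L$: $\widehat\phi_{JL}\widehat\phi_{IJ}=\widehat\phi_{IL}$, $\phi_{IJ}^{-1}(U_{JL})\subset U_{IL}$, and $\phi_{JL}\phi_{IJ}=\phi_{IL}$ on $\phi_{IJ}^{-1}(U_{JL})$. It satisfies the strong cocycle condition if always $\phi_{IJ}^{-1}(U_{JL})=U_{IL}$. Conventions: $U_{II}=U_I$, $\phi_{II}=\mathrm{id}$, $s_J^{-1}(E_I)=s_J^{-1}(\widehat\phi_{IJ}(E_I))$. $\mathcal K$ is tame if it is additive (each map $\prod_{i\in I}E_i\to E_I$, $(e_i)\mapsto\sum\widehat\phi_{iI}(e_i)$ is an isomorphism) and, for all indices (equalities allowed), $U_{IJ}\cap U_{IL}=U_{I(J\cup L)}$ for $I\subset J,L$ (with $U_{IH}=\emptyset$ for $H\notin\mathcal I_{\mathcal K}$) and $\phi_{IJ}(U_{IL})=U_{JL}\cap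 s_J^{-1}(E_I)$ for $I\subset J\subset L$. The domain category $\mathbf B_{\mathcal K}$ has object space $\bigsqcup_{I\in\mathcal I_{\mathcal K}}U_I$ and morphism space $\bigsqcup_{I\subset J}U_{IJ}$, where $(I,J,x)$ is a morphism from $(I,x)$ to $(J,\phi_{IJ}(x))$. $|\mathcal K|=\bigsqcup_IU_I/\!\sim$, with $\sim$ generated by existence of a morphism and quotient topology, has projection $\pi_{\mathcal K}$; $\iota_{\mathcal K}:X\to|\mathcal K|$, $p\mapsto[I,\psi_I^{-1}(p)]$ for any $I$ with $p\in F_I$. A reduction of $\mathcal K$ is an open subset $\mathcal V=\bigsqcup V_I\subset\bigsqcup U_I$ with each $V_I$ precompact in $U_I$, $V_I\cap s_I^{-1}(0)\neq\emptyset$ if $V_I\neq\emptyset$; $\pi_{\mathcal K}(\overline{V_I})\cap\pi_{\mathcal K}(\overline{V_J})\neq\emptyset$ only if $I\subset J$ or $J\subset I$; and $\iota_{\mathcal K}(X)\subset\pi_{\mathcal K}(\mathcal V)$. *)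

(* Defs.v *)
From HB Require Import structures.
From Stdlib Require Import Relation_Operators.
From mathcomp Require Import all_boot all_order all_algebra.
From mathcomp Require Import generic_quotient.
From mathcomp Require Import all_classical all_reals all_analysis.
Import Order.TTheory GRing.Theory Num.Theory.
Import numFieldNormedType.Exports.

Set Implicit Arguments.
Unset Strict Implicit.
Unset Printing Implicit Defensive.

Local Open Scope classical_set_scope.
Local Open Scope ring_scope.

Definition metrizable (R : realType) (X : topologicalType) : Prop :=
  exists d : X -> X -> R,
    [/\ forall x y, (d x y == 0) = (x == y),
        forall x y, d x y = d y x,
        forall x y z, d x z <= d x y + d y z
      & forall x (A : set X),
          nbhs x A <-> exists2 e : R, 0 < e & [set y | d x y < e] `<=` A].

(* [f] restricts to a homeomorphism from the subspace [A] onto the subspace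
   [f @` A]. *)
Definition embeds_on (S T : topologicalType) (A : set S) (f : S -> T) : Prop :=
  [/\ {in A &, injective f},
      {within A, continuous f}
    & forall O : set S, open O ->
        exists2 O' : set T, open O' & f @` (A `&` O) = f @` A `&` O'].

(* C^k on an open set [A]: for [k.+1], (Frechet) differentiable on [A] with all
   directional derivatives of class C^k on [A]. *)
Fixpoint class_C (R : realType) (k m n : nat) (A : set 'rV[R]_m)
    (f : 'rV[R]_m -> 'rV[R]_n) : Prop :=
  match k with
  | 0 => forall x, A x -> {for x, continuous f}
  | k'.+1 => (forall x, A x -> differentiable f x) /\
             forall v, class_C k' A (fun x => 'D_v f x)
  end.

Definition class_Coo (R : realType) (m n : nat) (A : set 'rV[R]_m)
    (f : 'rV[R]_m -> 'rV[R]_n) : Prop :=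
  forall k, class_C k A f.

(* A coordinate system; [toR] is meaningful on [cdom] and [ofR] on [cimg]. *)
Record coords (R : realType) (M : topologicalType) (n : nat) := Coords {
  cdom : set M;
  cimg : set 'rV[R]_n;
  toR : M -> 'rV[R]_n;
  ofR : 'rV[R]_n -> M;
  cdom_open : open cdom;
  cimg_open : open cimg;
  toR_img : forall x, cdom x -> cimg (toR x);
  ofR_dom : forall y, cimg y -> cdom (ofR y);
  toRK : forall x, cdom x -> ofR (toR x) = x;
  ofRK : forall y, cimg y -> toR (ofR y) = y;
  toR_cont : {within cdom, continuous toR};
  ofR_cont : {within cimg, continuous ofR} }.

Record manifold (R : realType) := Manifold {
  mtop :> topologicalType;
  mdim : nat;
  mcoords : set (coords R mtop mdim);
  mhausdorff : hausdorff_space mtop;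
  msecond_countable : @second_countable mtop;
  mcover : forall x : mtop, exists2 a, mcoords a & cdom a x;
  mcompat : forall a b, mcoords a -> mcoords b ->
    class_Coo [set y | cimg a y /\ cdom b (ofR a y)] (toR b \o ofR a) }.

Section SmoothMaps.
Context {R : realType}.
Implicit Types M N : manifold R.

Definition smooth_on M N (A : set M) (f : M -> N) : Prop :=
  {within A, continuous f} /\
  forall a b, mcoords a -> mcoords b ->
    class_Coo [set y | [/\ cimg a y, A (ofR a y) & cdom b (f (ofR a y))]]
      (toR b \o f \o ofR a).

(* Abstract finite dimensional vector spaces carry no norm in the library: they
   are read through their linear coordinates in a basis. *)
Definition vcoord (E : vectType R) : E -> 'rV[R]_(\dim {:E}) :=
  passmx.rVof (vbasis {:E}).
Definition vcoord_inv (E : vectType R) : 'rV[R]_(\dim {:E}) -> E :=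
  passmx.vecof (vbasis {:E}).

Definition smooth_vec M (E : vectType R) (s : M -> E) : Prop :=
  forall a, mcoords a -> class_Coo (cimg a) (@vcoord E \o s \o ofR a).

Definition diffeo M N (f : M -> N) : Prop :=
  smooth_on setT f /\
  exists g : N -> M, [/\ smooth_on setT g, cancel f g & cancel g f].

(* The differential d_u f, read in coordinates [a] around [u] and [b] around
   [f u]. *)
Definition dmap M N (f : M -> N) (a : coords R M (mdim M))
    (b : coords R N (mdim N)) (u : M) : 'Hom('rV[R]_(mdim M), 'rV[R]_(mdim N)) :=
  linfun ('d (toR b \o f \o ofR a) (toR a u)).

(* The differential d_u s : T_u M -> E, read in coordinates [a] around [u]. *)
Definition dvec M (E : vectType R) (s : M -> E) (a : coords R M (mdim M))
    (u : M) : 'Hom('rV[R]_(mdim M), E) :=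
  linfun (@vcoord_inv E \o 'd (@vcoord E \o s \o ofR a) (toR a u)).

Definition smooth_embedding M N (A : set M) (f : M -> N) : Prop :=
  [/\ smooth_on A f, embeds_on A f
    & forall u, A u -> forall a b, mcoords a -> cdom a u ->
        mcoords b -> cdom b (f u) -> lker (dmap f a b u) = 0%VS].

End SmoothMaps.

Definition direct_sum (R : realType) (E : vectType R) (A B : {vspace E}) : Prop :=
  (A + B = fullv)%VS /\ (A :&: B = 0)%VS.

(* [kpsi] is meaningful on the zero set of [ksec] only. *)
Record kchart (R : realType) (X : topologicalType) := KChart {
  kdom : manifold R;
  kobs : vectType R;
  ksec : kdom -> kobs;
  kpsi : kdom -> X;
  kfoot : set X;
  ksec_smooth : smooth_vec ksec;
  kpsi_embeds : embeds_on [set x | ksec x = 0] kpsi;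
  kpsi_image : kpsi @` [set x | ksec x = 0] = kfoot;
  kfoot_open : open kfoot;
  kfoot_neq0 : kfoot !=set0 }.

Definition kzero (R : realType) (X : topologicalType) (K : kchart R X) :
  set (kdom K) := [set x | ksec x = 0].

(* The index condition at a point [u] of the domain of [phi]. *)
Definition index_condition (R : realType) (X : topologicalType)
    (K L : kchart R X) (phi : kdom K -> kdom L)
    (phihat : 'Hom(kobs K, kobs L)) (u : kdom K) : Prop :=
  forall a b, mcoords a -> cdom a u -> mcoords b -> cdom b (phi u) ->
    (dmap phi a b u @: lker (dvec (@ksec _ _ K) a u))%VS =
      lker (dvec (@ksec _ _ L) b (phi u)) /\
    forall C : {vspace kobs K},
      direct_sum (limg (dvec (@ksec _ _ K) a u)) C ->
      direct_sum (limg (dvec (@ksec _ _ L) b (phi u))) (phihat @: C)%VS.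

(* [cphi] is meaningful on [cset] only. *)
Record coord_change (R : realType) (X : topologicalType) (K L : kchart R X) :=
  CoordChange {
  cset : set (kdom K);
  cphi : kdom K -> kdom L;
  chat : 'Hom(kobs K, kobs L);
  cset_open : open cset;
  cset_zero : cset `&` @kzero _ _ K =
    @kzero _ _ K `&` (@kpsi _ _ K) @^-1` (kfoot K `&` kfoot L);
  cphi_embedding : smooth_embedding cset cphi;
  chat_inj : injective chat;
  csec : forall x, cset x -> ksec (cphi x) = chat (ksec x);
  cpsi : forall x, cset x -> kzero x -> kpsi (cphi x) = kpsi x;
  cindex : forall x, cset x -> index_condition cphi chat x }.

Section Nerve.
Context {X : Type} {T : finType}.
Implicit Type F : T -> set X.

Definition footI F (I : {set T}) : set X :=
  [set p | forall i, i \in I -> F i p].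

Definition in_nerve F (I : {set T}) : bool :=
  (I != finset.set0) && `[< footI F I !=set0 >].

Definition nerve F : finType := {I : {set T} | in_nerve F I}.

Lemma footI1 F i : footI F [set i]%SET = F i.
Proof.
apply/seteqP; split=> p /=; first by apply; rewrite finset.inE.
by move=> Fip j; rewrite finset.inE => /eqP ->.
Qed.

Lemma nerve1_subproof F (F0 : forall i, F i !=set0) i :
  in_nerve F [set i]%SET.
Proof.
apply/andP; split; last by apply/asboolP; rewrite footI1.
by apply/finset.set0Pn; exists i; rewrite finset.inE.
Qed.

Definition nerve1 F (F0 : forall i, F i !=set0) i : nerve F :=
  exist _ [set i]%SET (nerve1_subproof F0 i).

End Nerve.

(* The basic charts are the charts [chart [set i]]; the finite type [basic]
   plays the role of {1, ..., N}.  Coordinate changes are given for all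
   inclusions [I \subset J], those for [I = J] being identities; for these the
   cocycle condition holds trivially. *)
Record atlas (R : realType) (X : topologicalType) (d : int) := Atlas {
  basic : finType;
  foot : basic -> set X;
  foot_neq0 : forall i, foot i !=set0;
  foot_cover : forall p, exists i, foot i p;
  chart : nerve foot -> kchart R X;
  chart_foot : forall I, kfoot (chart I) = footI foot (val I);
  chart_dim : forall I,
    (mdim (kdom (chart I)))%:Z - (\dim {: kobs (chart I)})%:Z = d;
  cc : forall I J : nerve foot, val I \subset val J ->
    coord_change (chart I) (chart J);
  cc_id : forall (I : nerve foot) (h : val I \subset val I),
    [/\ cset (cc h) = setT, cphi (cc h) =1 id & chat (cc h) =1 id];
  cc_hat : forall (I J L : nerve foot) (hIJ : val I \subset val J)
      (hJL : val J \subset val L) (hIL : val I \subset val L),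
    chat (cc hJL) \o chat (cc hIJ) =1 chat (cc hIL);
  cc_cset : forall (I J L : nerve foot) (hIJ : val I \subset val J)
      (hJL : val J \subset val L) (hIL : val I \subset val L),
    cset (cc hIJ) `&` cphi (cc hIJ) @^-1` cset (cc hJL) `<=` cset (cc hIL);
  cc_cphi : forall (I J L : nerve foot) (hIJ : val I \subset val J)
      (hJL : val J \subset val L) (hIL : val I \subset val L) x,
    cset (cc hIJ) x -> cset (cc hJL) (cphi (cc hIJ) x) ->
    cphi (cc hJL) (cphi (cc hIJ) x) = cphi (cc hIL) x }.

Section AtlasTheory.
Context {R : realType} {X : topologicalType} {d : int}.
Implicit Type K : atlas R X d.

Definition idx K : finType := nerve (@foot _ _ _ K).
Definition dom K (I : idx K) : manifold R := kdom (chart I).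
Definition obs K (I : idx K) : vectType R := kobs (chart I).
Definition bidx K (i : basic K) : idx K := nerve1 (@foot_neq0 _ _ _ K) i.

Definition strong_cocycle K : Prop :=
  forall (I J L : idx K) (hIJ : val I \subset val J)
    (hJL : val J \subset val L) (hIL : val I \subset val L),
  cset (cc hIJ) `&` cphi (cc hIJ) @^-1` cset (cc hJL) = cset (cc hIL).

Lemma bidx_sub K (I : idx K) (i : {i | i \in val I}) :
  val (bidx (val i)) \subset val I.
Proof. by rewrite finset.sub1set; exact: valP i. Qed.

Definition obs_sum K (I : idx K)
    (e : forall i : {i | i \in val I}, obs (bidx (val i))) : obs I :=
  \sum_(i : {i | i \in val I}) chat (cc (bidx_sub i)) (e i).

Definition additive K : Prop := forall I : idx K, bijective (@obs_sum K I).

(* U_{IH} for an arbitrary set [H] of basic indices: empty unless [H] is an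
   index of the atlas. *)
Definition csetU K (I : idx K) (H : {set basic K}) : set (dom I) :=
  [set x | exists (J : idx K) (h : val I \subset val J),
     val J = H /\ cset (cc h) x].

Arguments csetU K I H : clear implicits.

Definition tame K : Prop :=
  [/\ additive K,
      forall (I J L : idx K) (hIJ : val I \subset val J)
          (hIL : val I \subset val L),
        cset (cc hIJ) `&` cset (cc hIL) = csetU K I (val J :|: val L)%SET
    & forall (I J L : idx K) (hIJ : val I \subset val J)
          (hJL : val J \subset val L) (hIL : val I \subset val L),
        cphi (cc hIJ) @` cset (cc hIL) =
        cset (cc hJL) `&` [set y | exists e : obs I, ksec y = chat (cc hIJ) e]].

Definition obj K : topologicalType := {I : idx K & dom I}.

Definition arrow K : finType := {p : idx K * idx K | val p.1 \subset val p.2}.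

Definition mor K : topologicalType :=
  {p : arrow K & set_type (cset (cc (proj2_sig p)))}.

Definition asrc K (m : mor K) : idx K := (proj1_sig (projT1 m)).1.
Definition atgt K (m : mor K) : idx K := (proj1_sig (projT1 m)).2.
Definition apt K (m : mor K) : dom (asrc m) := val (projT2 m).

Definition msrc K (m : mor K) : obj K := existT _ (asrc m) (apt m).
Definition mtgt K (m : mor K) : obj K :=
  existT _ (atgt m) (cphi (cc (proj2_sig (projT1 m))) (apt m)).

Definition mk_mor K (I J : idx K) (h : val I \subset val J) (x : dom I)
    (hx : cset (cc h) x) : mor K :=
  existT (fun p : arrow K => set_type (cset (cc (proj2_sig p))))
    (exist (fun p : idx K * idx K => val p.1 \subset val p.2) (I, J) h)
    (exist _ x (mem_set hx) : set_type (cset (cc h))).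

Lemma id_cset K (o : obj K) : cset (cc (subxx (val (projT1 o)))) (projT2 o).
Proof. by have [-> _ _] := cc_id (subxx (val (projT1 o))). Qed.

Definition mid K (o : obj K) : mor K := mk_mor (id_cset o).

Lemma comp_sub K (m n : mor K) : mtgt m = msrc n ->
  val (asrc m) \subset val (atgt n).
Proof.
case: m => -[[I J] hIJ] x; case: n => -[[J' L] hJL] y /(congr1 (@projT1 _ _)) /=.
rewrite /atgt /asrc /= => eJ; apply: (fintype.subset_trans hIJ).
by rewrite /= eJ.
Qed.

Lemma comp_cset K (m n : mor K) (e : mtgt m = msrc n) :
  cset (cc (comp_sub e)) (apt m).
Proof.
have gen (I J : idx K) (hIJ : val I \subset val J) (x : dom I) (o : obj K) :
    cset (cc hIJ) x -> existT _ J (cphi (cc hIJ) x) = o ->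
    forall (L : idx K) (hJL : val (projT1 o) \subset val L)
      (hIL : val I \subset val L),
    cset (cc hJL) (projT2 o) -> cset (cc hIL) x.
  by move=> hx <- L hJL hIL hy; apply: (cc_cset (hJL := hJL)); split; first exact: hx.
move: (comp_sub e) => h.
exact: (gen _ _ _ _ _ (set_mem (valP (projT2 m))) e _ _ h
  (set_mem (valP (projT2 n)))).
Qed.

(* The composite of (I, J, x) and (J, L, phi_IJ x) is (I, L, x). *)
Definition mcomp K (m n : mor K) (e : mtgt m = msrc n) : mor K :=
  mk_mor (comp_cset e).

Lemma msrc_id K (o : obj K) : msrc (mid o) = o.
Proof. by case: o. Qed.

Lemma mtgt_id K (o : obj K) : mtgt (mid o) = o.
Proof.
case: o => I x; rewrite /mtgt /atgt /apt /=.
by congr existT; have [_ -> _] := cc_id (subxx (val I)).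
Qed.

Lemma msrc_comp K (m n : mor K) (e : mtgt m = msrc n) :
  msrc (mcomp e) = msrc m.
Proof. by []. Qed.

Lemma mtgt_comp K (m n : mor K) (e : mtgt m = msrc n) :
  mtgt (mcomp e) = mtgt n.
Proof.
have gen (I J : idx K) (hIJ : val I \subset val J) (x : dom I) (o : obj K) :
    cset (cc hIJ) x -> existT _ J (cphi (cc hIJ) x) = o ->
    forall (L : idx K) (hJL : val (projT1 o) \subset val L)
      (hIL : val I \subset val L), cset (cc hJL) (projT2 o) ->
    cphi (cc hIL) x = cphi (cc hJL) (projT2 o).
  move=> hx <- L hJL hIL hy /=; symmetry; exact: cc_cphi hy.
rewrite /mtgt /=; congr existT.
exact: (gen _ _ _ _ _ (set_mem (valP (projT2 m))) e _ _ _
  (set_mem (valP (projT2 n)))).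
Qed.

Lemma mor_thin K (m n : mor K) : msrc m = msrc n -> mtgt m = mtgt n -> m = n.
Proof.
case: m => -[[I J] h] [x hx]; case: n => -[[I' J'] h'] [x' hx'] es et.
have /= eI := congr1 (@projT1 _ _) es; have /= eJ := congr1 (@projT1 _ _) et.
rewrite /asrc /atgt /= in eI eJ; subst I' J'.
have eh : h' = h by exact: bool_irrelevance.
subst h'.
have ex : x = x' by exact: existT_inj2 es.
by subst x'; have -> : hx' = hx by exact: bool_irrelevance.
Qed.

(* Functors between these topological categories are continuous on objects and
   on morphisms. *)
Record bfunctor K K' := BFunctor {
  fobj :> obj K -> obj K';
  fmor : mor K -> mor K';
  fobj_cont : continuous fobj;
  fmor_cont : continuous fmor;
  fmor_src : forall m, msrc (fmor m) = fobj (msrc m);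
  fmor_tgt : forall m, mtgt (fmor m) = fobj (mtgt m);
  fmor_id : forall o, fmor (mid o) = mid (fobj o);
  fmor_comp : forall (m n : mor K) (e : mtgt m = msrc n)
    (e' : mtgt (fmor m) = msrc (fmor n)), fmor (mcomp e) = mcomp e' }.

Definition faithful K K' (F : bfunctor K K') : Prop :=
  forall m n, msrc m = msrc n -> mtgt m = mtgt n -> fmor F m = fmor F n -> m = n.

Definition robj K : rel (obj K) := fun x y =>
  `[< clos_refl_sym_trans (obj K)
        (fun a b => exists m : mor K, msrc m = a /\ mtgt m = b) x y >].

Lemma robj_equiv K : equiv_class_of (@robj K).
Proof.
split; first by move=> x; apply/asboolP; exact: rst_refl.
- by move=> x y; apply/asboolP/asboolP; exact: rst_sym.
- move=> y x z /asboolP xy /asboolP yz; apply/asboolP; exact: rst_trans xy yz.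
Qed.

Canonical robj_equivRel K := EquivRelPack (@robj_equiv K).

Definition realization K : topologicalType :=
  quotient_topology {eq_quot (robj_equivRel K)}%qT.

Definition piK K (o : obj K) : realization K :=
  (\pi_({eq_quot (robj_equivRel K)}) o)%qT.

Definition zobj K (o : obj K) : Prop := @kzero _ _ (chart (projT1 o)) (projT2 o).
Definition pobj K (o : obj K) : X := @kpsi _ _ (chart (projT1 o)) (projT2 o).

Lemma ex_zobj K (p : X) : exists o : obj K, zobj o /\ pobj o = p.
Proof.
have [i Fip] := foot_cover K p.
have : kfoot (chart (bidx i)) p by rewrite chart_foot footI1.
rewrite -kpsi_image => -[x x0 xp].
by exists (existT _ (bidx i) x).
Qed.

(* p |-> [I, psi_I^{-1}(p)] for a choice of [I] with p \in F_I; see [iotaK_pobj]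
   for the independence of the choice. *)
Definition iotaK K (p : X) : realization K := piK (projT1 (cid (ex_zobj K p))).

Lemma piK_mor K (m : mor K) : piK (msrc m) = piK (mtgt m).
Proof.
by apply/eqmodP => /=; apply/asboolP; apply: rst_step; exists m.
Qed.

Lemma piK_zobj K (I H : idx K) (h : val I \subset val H) (x : dom I) :
  kzero x -> kfoot (chart H) (kpsi x) ->
  exists y : dom H, [/\ kzero y, kpsi y = kpsi x &
    piK (existT (fun I => dom I) I x) = piK (existT (fun I => dom I) H y)].
Proof.
move=> x0 Hx.
have [hx _] : (cset (cc h) `&` @kzero _ _ (chart I)) x.
  by rewrite cset_zero; split=> //; split=> //; rewrite -kpsi_image; exists x.
exists (cphi (cc h) x); split; last by have := piK_mor (mk_mor hx).
- rewrite /kzero /= csec //.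
  by move: x0; rewrite /kzero /= => ->; rewrite linear0.
- exact: cpsi.
Qed.

Lemma iotaK_pobj K (o : obj K) : zobj o -> iotaK K (pobj o) = piK o.
Proof.
rewrite /iotaK; case: cid => /= o' [].
case: o' => J y; case: o => I x; rewrite /zobj /pobj /= => y0 yx x0.
have Ix : kfoot (chart I) (kpsi x) by rewrite -kpsi_image; exists x.
have Jx : kfoot (chart J) (kpsi x) by rewrite -kpsi_image; exists y.
have HH : footI (@foot _ _ _ K) (val I :|: val J)%SET (kpsi x).
  move: Ix Jx; rewrite !chart_foot => Ix Jx i.
  by rewrite finset.inE => /orP[/Ix|/Jx].
have nH : in_nerve (@foot _ _ _ K) (val I :|: val J)%SET.
  apply/andP; split; last by apply/asboolP; exists (kpsi x).
  have /andP[/finset.set0Pn[i iI] _] := valP I.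
  by apply/finset.set0Pn; exists i; rewrite finset.inE iI.
pose H : idx K := exist (fun I => in_nerve (@foot _ _ _ K) I) _ nH.
have IH : val I \subset val H by exact: finset.subsetUl.
have JH : val J \subset val H by exact: finset.subsetUr.
have Hx : kfoot (chart H) (kpsi x) by rewrite chart_foot.
have [x' [x'0 x'x ->]] := piK_zobj IH x0 Hx.
have [y' [y'0 y'y ->]] : exists y' : dom H, [/\ kzero y', kpsi y' = kpsi y &
    piK (existT (fun I => dom I) J y) = piK (existT (fun I => dom I) H y')].
  by apply: (piK_zobj JH y0); rewrite yx.
have [inj _ _] := kpsi_embeds (chart H).
suff -> : y' = x' by [].
by apply: inj; [exact/mem_set|exact/mem_set|rewrite y'y x'x].
Qed.

Definition slice K (V : set (obj K)) (I : idx K) : set (dom I) :=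
  [set x | V (existT _ I x)].

Arguments slice [K] V I _.

Record reduction K := Reduction {
  rset :> set (obj K);
  rset_open : open rset;
  rset_precompact : forall I, precompact (slice rset I);
  rset_zero : forall I, slice rset I !=set0 ->
    slice rset I `&` @kzero _ _ (chart I) !=set0;
  rset_nested : forall I J : idx K,
    [set piK (existT _ I x) | x in closure (slice rset I)] `&`
    [set piK (existT _ J y) | y in closure (slice rset J)] !=set0 ->
    val I \subset val J \/ val J \subset val I;
  rset_iota : range (@iotaK K) `<=` @piK K @` rset }.

Record atlas_iso K K' := AtlasIso {
  iso_basic : basic K -> basic K';
  iso_idx : idx K -> idx K';
  iso_dom : forall I, dom I -> dom (iso_idx I);
  iso_obs : forall I, 'Hom(obs I, obs (iso_idx I));
  iso_basic_bij : bijective iso_basic;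
  iso_foot : forall i, foot (iso_basic i) = foot i;
  iso_idxE : forall I, val (iso_idx I) = iso_basic @: val I;
  iso_dom_diffeo : forall I, diffeo (@iso_dom I);
  iso_obs_bij : forall I, bijective (iso_obs I);
  iso_sec : forall I (x : dom I), ksec (iso_dom x) = iso_obs I (ksec x);
  iso_psi : forall I (x : dom I), kzero x -> kpsi (iso_dom x) = kpsi x;
  iso_cset : forall (I J : idx K) (h : val I \subset val J)
      (h' : val (iso_idx I) \subset val (iso_idx J)) x,
    cset (cc h') (iso_dom x) <-> cset (cc h) x;
  iso_cphi : forall (I J : idx K) (h : val I \subset val J)
      (h' : val (iso_idx I) \subset val (iso_idx J)) x,
    cset (cc h) x -> cphi (cc h') (iso_dom x) = iso_dom (cphi (cc h) x);
  iso_chat : forall (I J : idx K) (h : val I \subset val J)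
      (h' : val (iso_idx I) \subset val (iso_idx J)) e,
    chat (cc h') (iso_obs I e) = iso_obs J (chat (cc h) e) }.

Definition iso_obj K K' (g : atlas_iso K K') (o : obj K) : obj K' :=
  existT _ (iso_idx g (projT1 o)) (iso_dom g (projT2 o)).

End AtlasTheory.

(* Canonicity of an assignment (K, V) |-> (K^V, iota^V : B_{K^V} -> B_K): it
   respects isomorphisms, i.e. every isomorphism K -> K' over X carrying V to V'
   lifts along iota^V, iota^V' to an isomorphism K^V -> K'^V'.  Morphisms of
   these categories are determined by their source and target, so that the
   square of functors commutes as soon as it commutes on objects. *)
Definition natural_reduction (R : realType) (X : topologicalType) (d : int)
    (red : forall K : atlas R X d, tame K -> reduction K -> atlas R X d)
    (incl : forall (K : atlas R X d) (tK : tame K) (V : reduction K),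
              bfunctor (red K tK V) K) : Prop :=
  forall (K K' : atlas R X d) (tK : tame K) (tK' : tame K')
    (V : reduction K) (V' : reduction K') (g : atlas_iso K K'),
  (forall o : obj K, rset V' (iso_obj g o) <-> rset V o) ->
  exists gV : atlas_iso (red K tK V) (red K' tK' V'),
    forall o, incl K' tK' V' (iso_obj gV o) = iso_obj g (incl K tK V o).

(* Main.v *)
(* Each chart of K is shrunk to the set of points of U_I carried into V by some
   coordinate change (including the identity), and the coordinate changes are
   restricted accordingly.  Since the reduction is nested, the points of V over
   a given p in X have indices forming a chain; hence the intersection over
   i in I of the new basic footprints is exactly the footprint of the shrunk
   chart at I, and K^V is an atlas over the nerve of the new footprints.
   Tameness makes phi_IL factor through every intermediate J, whence the strong
   cocycle condition, and it makes "phi_IL x = phi_JL y for some L" an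
   equivalence relation, namely the one defining |K|.  Two points of K^V with
   the same image in |K| are first moved into V, where their indices are nested
   and one is the image of the other under a coordinate change of K^V. *)
From mathcomp Require Import all_boot all_order all_algebra.
From mathcomp Require Import generic_quotient.
From mathcomp Require Import all_classical all_reals all_analysis.
Require Import Defs.
Import GRing.Theory.
Import numFieldNormedType.Exports.

Set Implicit Arguments.
Unset Strict Implicit.
Unset Printing Implicit Defensive.

Local Open Scope classical_set_scope.
Local Open Scope ring_scope.

(** * Restricting smooth maps to open submanifolds *)

Section LocalDifferentials.
Context {R : realType} {V W : normedModType R}.
Implicit Types (f g : V -> W) (x : V).

(** ['d] is chosen by [get] from a predicate on linear maps. Functions with the same germ give the
    same predicate, hence the same choice, also at points where they are not differentiable. *)
Lemma near_eq_diff f g x : (\forall y \near x, f y = g y) -> 'd f x = 'd g x.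
Proof.
move=> fg; have fgx : f x = g x := nbhs_singleton fg.
rewrite /diff; congr (get _); apply/funext => df; apply/propext; rewrite lim_id //.
have eqP h : (forall y, h y = h x + df (y - x) +o_(y \near x) (y - x)) <->
    h = (fun y => h x + df (y - x)) +o_x (fun y => y - x).
  by rewrite funeqE.
split=> -[cdf /eqP /eqaddoP H]; split=> //; apply/eqP/eqaddoP => e e0;
  have := H e e0; apply: filterS2 fg => y /=; rewrite !fctE fgx => ->; exact.
Qed.

Lemma near_eq_differentiable f g x :
  (\forall y \near x, f y = g y) -> differentiable f x -> differentiable g x.
Proof.
move=> fg /diff_locallyP[cdf /eqaddoP H]; apply/diff_locallyP.
rewrite -(near_eq_diff fg); split=> //; apply/eqaddoP => e e0.
have fg0 : \forall h \near (0 : V), f (h + x) = g (h + x).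
  by move: fg; rewrite (near_shift 0 x); apply: filterS => h /=; rewrite subr0.
have := H e e0; apply: filterS2 fg0 => y /=; rewrite !fctE /= => ->.
by rewrite (nbhs_singleton fg).
Qed.

End LocalDifferentials.

(** Restricted maps take arbitrary values off the relevant open set, so smoothness must be
    insensitive to them. On the open set [B] equal functions have equal directional derivatives,
    which lets the induction on [k] proceed. *)
Lemma class_C_local (R : realType) k m n (A B : set 'rV[R]_m)
    (f g : 'rV[R]_m -> 'rV[R]_n) :
  open B -> B `<=` A -> {in B, f =1 g} -> class_C k A f -> class_C k B g.
Proof.
move=> oB BA.
have near_fg U (h h' : _ -> U) x :
    {in B, h =1 h'} -> B x -> \forall y \near x, h y = h' y.
  move=> hh' Bx; apply: filterS (open_nbhs_nbhs (conj oB Bx)) => y /mem_set.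
  exact: hh'.
elim: k f g => [|k IHk] f g fg.
  move=> Af x Bx; have fgx := near_fg _ _ _ _ fg Bx.
  have := Af x (BA _ Bx); rewrite /prop_for /continuous_at (nbhs_singleton fgx).
  by apply: cvg_trans; exact: near_eq_cvg fgx.
move=> [Adf Ackf]; split=> [x Bx|v].
  exact: near_eq_differentiable (near_fg _ _ _ _ fg Bx) (Adf x (BA _ Bx)).
apply: IHk (Ackf v) => x /set_mem Bx.
exact: near_eq_derive (near_fg _ _ _ _ fg Bx).
Qed.

Lemma class_Coo_local (R : realType) m n (A B : set 'rV[R]_m)
    (f g : 'rV[R]_m -> 'rV[R]_n) :
  open B -> B `<=` A -> {in B, f =1 g} -> class_Coo A f -> class_Coo B g.
Proof. by move=> oB BA fg Af k; exact: class_C_local (Af k). Qed.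

(** * Subspaces as types and restriction of maps to them *)

Section SetType.
Context {T : topologicalType} (A : set T).

Lemma set_val_continuous : continuous (set_val : set_type A -> T).
Proof. exact: initial_continuous. Qed.

Lemma within_continuousP (U : topologicalType) (f : T -> U) :
  {within A, continuous f} <->
  forall O, open O -> exists2 G, open G & A `&` f @^-1` O = A `&` G.
Proof.
split=> [/continuousP cf O oO|cf].
  by have /open_subspaceP[G oG e] := cf O oO; exists G => //; rewrite setIC -e setIC.
apply/continuousP => O oO; apply/open_subspaceP; have [G oG e] := cf O oO.
by exists G => //; rewrite setIC -e setIC.
Qed.

Lemma open_within_preimage (U : topologicalType) (f : T -> U) (O : set U) :
  open A -> {within A, continuous f} -> open O -> open (A `&` f @^-1` O).
Proof.
by move=> oA /within_continuousP cf /cf[G oG ->]; exact: openI.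
Qed.

Lemma set_val_inj : injective (set_val : set_type A -> T).
Proof. exact: val_inj. Qed.

Lemma set_type_continuousP (U : topologicalType) (f : U -> set_type A) :
  continuous f <-> continuous (set_val \o f).
Proof.
split=> [cf x|/continuousP cf].
  by apply: continuous_comp; [exact: cf|exact: set_val_continuous].
by apply/continuousP => O [G oG <-]; exact: cf.
Qed.

Lemma set_type_hausdorff : hausdorff_space T -> hausdorff_space (set_type A).
Proof.
move=> hT p q pq; apply: val_inj; apply: hT => P Q Pp Qq.
have [| |x [Px Qx]] := pq (set_val @^-1` P) (set_val @^-1` Q).
- exact: set_val_continuous.
- exact: set_val_continuous.
- by exists (set_val x).
Qed.

Lemma set_type_second_countable :
  @second_countable T -> @second_countable (set_type A).
Proof.
move=> [B cB [Bo Bn]]; exists [set set_val @^-1` O | O in B].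
  exact: card_le_trans (card_image_le _ _) cB.
split=> [_ [G BG <-]|x P]; first by exists G => //; exact: Bo.
rewrite nbhsE => -[_ [[G oG <-] Gx] sP].
have [|G2 [BG2 G2x] sG2] := Bn (set_val x) G; first exact: open_nbhs_nbhs.
exists (set_val @^-1` G2); first by split=> //; exists G2.
by move=> y G2y; apply: sP; exact: sG2.
Qed.

(* A junk-valued retraction onto a nonempty subset, meaningful on [A] only. *)
Definition set_retr (A0 : A !=set0) (x : T) : set_type A :=
  insubd (exist (fun y => y \in A) _ (mem_set (projT2 (cid A0)))) x.

Lemma set_retrK (A0 : A !=set0) x : A x -> set_val (set_retr A0 x) = x.
Proof. by move=> /mem_set; exact: insubdK. Qed.

Lemma set_valK (A0 : A !=set0) (x : set_type A) : set_retr A0 (set_val x) = x.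
Proof. exact: valKd. Qed.

Lemma set_val_in (x : set_type A) : A (set_val x).
Proof. exact: set_mem (valP x). Qed.

Lemma ex_set_type x : A x -> exists y : set_type A, set_val y = x.
Proof. by move=> Ax; exists (exist _ x (mem_set Ax)). Qed.

End SetType.

Section Restriction.
Context {S T : topologicalType} (A : set S) (B : set T) (B0 : B !=set0).

Lemma within_comp_set_val (U : topologicalType) (D : set S) (f : S -> U) :
  {within D, continuous f} ->
  {within set_val @^-1` D, continuous (f \o set_val : set_type A -> U)}.
Proof.
move=> /within_continuousP cf; apply/within_continuousP => P oP.
have [Q oQ DQ] := cf P oP; exists (set_val @^-1` Q); first by exists Q.
by rewrite -[RHS](preimage_setI set_val) -DQ preimage_setI.
Qed.

Lemma within_set_retr_comp (D : set S) (f : S -> T) :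
  D `<=` f @^-1` B -> {within D, continuous f} ->
  {within D, continuous (set_retr B0 \o f)}.
Proof.
move=> DB /within_continuousP cf; apply/within_continuousP => _ [P oP <-].
have [Q oQ DQ] := cf P oP; exists Q; rewrite -?DQ //.
by apply/seteqP; split=> x [Dx /= Px]; split=> //;
  move: Px; rewrite /= set_retrK //; exact: DB.
Qed.

Definition restr_map (f : S -> T) : set_type A -> set_type B :=
  set_retr B0 \o f \o set_val.

(** The condition on the image cuts out the points where [restr_map] really agrees with [f];
    elsewhere the retraction may return its default point. *)
Definition restr_dom (D : set S) (f : S -> T) : set (set_type A) :=
  set_val @^-1` (D `&` f @^-1` B).

Lemma restr_mapE f x : B (f (set_val x)) -> set_val (restr_map f x) = f (set_val x).
Proof. exact: set_retrK. Qed.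

Lemma restr_dom_open D f :
  open D -> {within D, continuous f} -> open B -> open (restr_dom D f).
Proof.
move=> oD cf oB; exists (D `&` f @^-1` B) => //; exact: open_within_preimage.
Qed.

Lemma restr_map_continuous (D : set S) (f : S -> T) :
  {within D, continuous f} -> {within restr_dom D f, continuous (restr_map f)}.
Proof.
move=> cf; rewrite /restr_map /restr_dom.
apply: within_comp_set_val; apply: within_set_retr_comp.
  by move=> x [].
by apply: continuous_subspaceW cf => x [].
Qed.

Lemma restr_map_embeds (D : set S) (f : S -> T) :
  open A -> embeds_on D f -> embeds_on (restr_dom D f) (restr_map f).
Proof.
move=> oA [injf cf of_]; split.
- move=> x y /set_mem[Dx Bx] /set_mem[Dy By] /(congr1 set_val).
  rewrite !restr_mapE // => /injf fxy; apply: set_val_inj; apply: fxy;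
    exact/mem_set.
- exact: restr_map_continuous.
- move=> _ [P oP <-]; have [Q oQ DQ] := of_ _ (openI oA oP).
  exists (set_val @^-1` Q); first by exists Q.
  apply/seteqP; split=> [_ [x [[Dx Bx] Px] <-]|_ [[x [Dx Bx] <-]]] /=.
    split; first by exists x.
    have : (f @` D `&` Q) (f (set_val x)).
      rewrite -DQ; exists (set_val x) => //.
      by split=> //; split=> //; exact: set_val_in.
    by rewrite /= restr_mapE // => -[].
  rewrite restr_mapE // => Qx.
  have : (f @` (D `&` (A `&` P))) (f (set_val x)).
    by rewrite DQ; split=> //; exists (set_val x).
  (* Injectivity of [f] on [D] turns membership of the image in [Q] back into membership of the
     point in [P]. *)
  move=> [y [Dy [Ay Py]] /injf yx]; exists x => //; split=> //=.
  by rewrite -yx //; exact/mem_set.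
Qed.

End Restriction.

(** * Open subsets as manifolds, and differentials on them *)

Section Submanifold.
Context {R : realType} (M : manifold R) (A : set M).
Hypotheses (oA : open A) (A0 : A !=set0).

Section SubCoords.
Context {n : nat} (a : coords R M n).

Definition sub_cimg : set 'rV[R]_n := cimg a `&` ofR a @^-1` A.

Lemma sub_cdom_open : open (set_val @^-1` cdom a : set (set_type A)).
Proof. by exists (cdom a) => //; exact: cdom_open. Qed.

Lemma sub_cimg_open : open sub_cimg.
Proof. apply: open_within_preimage => //; [exact: cimg_open|exact: ofR_cont]. Qed.

Lemma sub_toR_img (x : set_type A) :
  cdom a (set_val x) -> sub_cimg (toR a (set_val x)).
Proof.
move=> ax; split; first exact: toR_img.
by rewrite /= toRK //; exact: set_val_in.
Qed.

Lemma sub_ofR_dom y : sub_cimg y -> cdom a (set_val (set_retr A0 (ofR a y))).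
Proof. by move=> [ay Ay]; rewrite set_retrK //; exact: ofR_dom. Qed.

Lemma sub_toRK (x : set_type A) :
  cdom a (set_val x) -> set_retr A0 (ofR a (toR a (set_val x))) = x.
Proof. by move=> ax; rewrite toRK // set_valK. Qed.

Lemma sub_ofRK y : sub_cimg y -> toR a (set_val (set_retr A0 (ofR a y))) = y.
Proof. by move=> [ay Ay]; rewrite set_retrK // ofRK. Qed.

Lemma sub_toR_cont :
  {within set_val @^-1` cdom a, continuous (toR a \o set_val : set_type A -> _)}.
Proof. apply: within_comp_set_val; exact: toR_cont. Qed.

Lemma sub_ofR_cont : {within sub_cimg, continuous (set_retr A0 \o ofR a)}.
Proof.
apply: within_set_retr_comp; first by move=> x [].
by apply: continuous_subspaceW (@ofR_cont _ _ _ a) => x [].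
Qed.

Definition sub_coords : coords R (set_type A) n :=
  Coords sub_cdom_open sub_cimg_open sub_toR_img sub_ofR_dom sub_toRK sub_ofRK
    sub_toR_cont sub_ofR_cont.

Lemma ofR_preimage_open (D : set M) : open D -> open (cimg a `&` ofR a @^-1` D).
Proof.
move=> oD; apply: open_within_preimage => //; [exact: cimg_open|exact: ofR_cont].
Qed.

End SubCoords.

Lemma sub_mcover (x : set_type A) :
  exists2 a, [set sub_coords a | a in @mcoords R M] a & cdom a x.
Proof.
by have [a Ma ax] := mcover (set_val x); exists (sub_coords a) => //; exists a.
Qed.

(** Where the retraction is the identity, the transition map is the old one on a smaller open
    set. *)
Lemma sub_mcompat a b : [set sub_coords a | a in @mcoords R M] a ->
  [set sub_coords a | a in @mcoords R M] b ->
  class_Coo [set y | cimg a y /\ cdom b (ofR a y)] (toR b \o ofR a).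
Proof.
move=> [{}a Ma <-] [{}b Mb <-] /=.
have -> : [set y | sub_cimg a y /\ cdom b (set_val (set_retr A0 (ofR a y)))] =
    cimg a `&` ofR a @^-1` (A `&` cdom b).
  apply/seteqP; split=> y /=; first by move=> [[ay Ay]]; rewrite set_retrK.
  by move=> [ay [Ay by_]]; rewrite set_retrK.
apply: class_Coo_local (mcompat Ma Mb).
- by apply: ofR_preimage_open; apply: openI => //; exact: cdom_open.
- by move=> y [ay [Ay by_]].
- by move=> y /set_mem[ay [Ay by_]] /=; rewrite set_retrK.
Qed.

Definition submanifold : manifold R :=
  Manifold (@set_type_hausdorff _ A (@mhausdorff R M))
    (@set_type_second_countable _ A (@msecond_countable R M)) sub_mcover sub_mcompat.

End Submanifold.

(** The factor [h] covers both kinds of differential: it is [id] for [dmap] and [vcoord_inv] for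
    [dvec]. *)
Lemma near_eq_linfun_diff (R : realType) (V : vectType R) m n
    (f g : 'rV[R]_m -> 'rV[R]_n) (h : 'rV[R]_n -> V) x :
  (\forall y \near x, f y = g y) ->
  linfun (h \o 'd f x) = linfun (h \o 'd g x).
Proof. by move=> /near_eq_diff ->. Qed.

Section SubmanifoldMaps.
Context {R : realType} (M N : manifold R) (A : set M) (B : set N).
Hypotheses (oA : open A) (A0 : A !=set0) (oB : open B) (B0 : B !=set0).

Lemma restr_smooth_on (D : set M) (f : M -> N) : open D -> smooth_on D f ->
  @smooth_on _ (submanifold oA A0) (submanifold oB B0)
    (restr_dom B D f) (restr_map B0 f).
Proof.
move=> oD [cf sf]; split; first exact: restr_map_continuous.
move=> _ _ [a Ma <-] [b Mb <-].
(* Without the retractions, the domain of the coordinate expression is an open part of the one for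
   [f], and both expressions agree there. *)
have domE : [set y | [/\ cimg (sub_coords oA A0 a) y,
    restr_dom B D f (ofR (sub_coords oA A0 a) y)
    & cdom (sub_coords oB B0 b) (restr_map B0 f (ofR (sub_coords oA A0 a) y))]] =
    cimg a `&` ofR a @^-1` (A `&` (D `&` f @^-1` (B `&` cdom b))).
  apply/seteqP; split=> y /=; rewrite /restr_dom /restr_map /=.
    by move=> [[ay Ay]]; rewrite /= set_retrK // => -[Dy By]; rewrite set_retrK.
  by move=> [ay [Ay [Dy [By by_]]]]; split=> //=; rewrite set_retrK //= set_retrK.
rewrite domE; apply: class_Coo_local (sf a b Ma Mb).
- apply: ofR_preimage_open; apply: openI => //; apply: open_within_preimage => //.
  by apply: openI => //; exact: cdom_open.
- by move=> y [ay [Ay [Dy [By by_]]]].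
- move=> y /set_mem[ay [Ay [Dy [By by_]]]].
  by rewrite /= /restr_map /= (set_retrK A0) // set_retrK.
Qed.

(** The coordinate expressions of [restr_map] and [f] agree near [toR a u], so the differentials are
    equal as linear maps between the same row spaces. *)
Lemma restr_dmap (D : set M) (f : M -> N) a b (u : set_type A) :
  open D -> {within D, continuous f} -> cdom a (set_val u) -> restr_dom B D f u ->
  @dmap _ (submanifold oA A0) (submanifold oB B0) (restr_map B0 f)
    (sub_coords oA A0 a) (sub_coords oB B0 b) u = dmap f a b (set_val u).
Proof.
move=> oD cf au [Du Bu]; apply: (@near_eq_linfun_diff _ _ _ _ _ _ id).
have oP : open (cimg a `&` ofR a @^-1` (A `&` (D `&` f @^-1` B))).
  apply: ofR_preimage_open; apply: openI => //; exact: open_within_preimage.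
have Pu : (cimg a `&` ofR a @^-1` (A `&` (D `&` f @^-1` B))) (toR a (set_val u)).
  split; first exact: toR_img.
  by rewrite /= toRK //; split=> //; exact: set_val_in.
apply: filterS (open_nbhs_nbhs (conj oP Pu)) => y [ay [Ay [Dy By]]].
by rewrite /= /restr_map /= (set_retrK A0) // set_retrK.
Qed.

Lemma restr_smooth_embedding (D : set M) (f : M -> N) :
  open D -> smooth_embedding D f ->
  @smooth_embedding _ (submanifold oA A0) (submanifold oB B0)
    (restr_dom B D f) (restr_map B0 f).
Proof.
move=> oD [sf ef kf]; split; [exact: restr_smooth_on|exact: restr_map_embeds|].
move=> u [Du Bu] _ _ [a Ma <-] au [b Mb <-] bu.
rewrite (restr_dmap _ oD) //; last exact: sf.1.
by apply: kf => //; move: bu; rewrite /= restr_mapE.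
Qed.

Lemma smooth_vec_set_val (E : vectType R) (s : M -> E) :
  smooth_vec s -> @smooth_vec _ (submanifold oA A0) E (s \o set_val).
Proof.
move=> ss _ [a Ma <-]; apply: class_Coo_local (ss a Ma).
- exact: sub_cimg_open.
- by move=> y [].
- by move=> y /set_mem[ay Ay] /=; rewrite set_retrK.
Qed.

Lemma dvec_set_val (E : vectType R) (s : M -> E)
    (a : coords R M (mdim M)) (u : set_type A) :
  cdom a (set_val u) ->
  @dvec _ (submanifold oA A0) E (s \o set_val) (sub_coords oA A0 a) u =
  dvec s a (set_val u).
Proof.
move=> au; have Pu : sub_cimg A a (toR a (set_val u)).
  split; first exact: toR_img.
  by rewrite /= toRK //; exact: set_val_in.
apply: near_eq_linfun_diff.
apply: filterS (open_nbhs_nbhs (conj (@sub_cimg_open _ _ _ oA _ a) Pu)) => y [ay Ay].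
by rewrite /= set_retrK.
Qed.

End SubmanifoldMaps.

(** As [f] and its inverse exchange [A] and [B], both restricted domains are everything and the
    retractions act trivially. *)
Lemma restr_diffeo (R : realType) (M N : manifold R) (A : set M) (B : set N)
    (oA : open A) (A0 : A !=set0) (oB : open B) (B0 : B !=set0) (f : M -> N) :
  (forall x, B (f x) <-> A x) -> diffeo f ->
  @diffeo _ (submanifold oA A0) (submanifold oB B0) (restr_map B0 f).
Proof.
move=> BA [sf [g [sg fK gK]]].
have AB y : A (g y) <-> B y by rewrite -BA gK.
have setTE : restr_dom B setT f = setT :> set (set_type A).
  by apply/seteqP; split=> // x _; split=> //; apply/BA; exact: set_val_in.
have setTE' : restr_dom A setT g = setT :> set (set_type B).
  by apply/seteqP; split=> // x _; split=> //; apply/AB; exact: set_val_in.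
split; first by rewrite -setTE; apply: restr_smooth_on; [exact: openT|].
exists (restr_map A0 g); split.
- by rewrite -setTE'; apply: restr_smooth_on; [exact: openT|].
- move=> x; apply: set_val_inj; have Ax := set_val_in x.
  have Bx : B (f (set_val x)) by apply/BA.
  by rewrite restr_mapE restr_mapE // fK.
- move=> x; apply: set_val_inj; have Bx := set_val_in x.
  have Ax : A (g (set_val x)) by apply/AB.
  by rewrite restr_mapE restr_mapE // gK.
Qed.

(** * Restricting charts and coordinate changes *)

Lemma embeds_on_set_val (S T : topologicalType) (A D : set S) (f : S -> T) :
  open A -> embeds_on D f ->
  embeds_on (set_val @^-1` D : set (set_type A)) (f \o set_val).
Proof.
move=> oA [injf cf of_]; split; last move=> _ [P oP <-].
- move=> x y /set_mem Dx /set_mem Dy fxy; apply: set_val_inj.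
  by apply: injf fxy; exact/mem_set.
- exact: within_comp_set_val.
- have [Q oQ DQ] := of_ _ (openI oA oP); exists Q => //.
  apply/seteqP; split=> [_ [x [Dx Px] <-]|_ [[x Dx <-] Qx]] /=.
    split; first by exists x.
    have : (f @` D `&` Q) (f (set_val x)).
      rewrite -DQ; exists (set_val x) => //.
      by split=> //; split=> //; exact: set_val_in.
    by move=> [].
  have : (f @` (D `&` (A `&` P))) (f (set_val x)).
    by rewrite DQ; split=> //; exists (set_val x).
  move=> [y [Dy [Ay Py]] /injf yx]; exists x => //; split=> //=.
  by rewrite -yx //; exact/mem_set.
Qed.

Section Subchart.
Context {R : realType} {X : topologicalType} (K : kchart R X) (A : set (kdom K)).
Hypotheses (oA : open A) (Az : A `&` @kzero _ _ K !=set0).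

Lemma nonempty_of_zero : A !=set0.
Proof. by case: Az => x [Ax _]; exists x. Qed.

Let M := submanifold oA nonempty_of_zero.

Definition sub_foot : set X := @kpsi _ _ K @` (A `&` @kzero _ _ K).

Lemma sub_kpsi_embeds :
  embeds_on [set x : M | ksec (set_val x) = 0] (@kpsi _ _ K \o set_val).
Proof. exact: embeds_on_set_val (kpsi_embeds K). Qed.

Lemma sub_kpsi_image :
  (@kpsi _ _ K \o set_val) @` [set x : M | ksec (set_val x) = 0] = sub_foot.
Proof.
apply/seteqP; split=> [_ [x x0 <-]|_ [x [Ax x0] <-]].
  by exists (set_val x) => //; split=> //; exact: set_val_in.
by have [y yx] := ex_set_type Ax; exists y; rewrite /= yx.
Qed.

(** The footprint map sends a relatively open part of the zero set to a relatively open part of the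
    old footprint, which is itself open. *)
Lemma sub_foot_open : open sub_foot.
Proof.
have [_ _ /(_ A oA)[Q oQ]] := kpsi_embeds K; rewrite kpsi_image setIC => e.
by rewrite /sub_foot e; apply: openI => //; exact: kfoot_open.
Qed.

Lemma sub_foot_neq0 : sub_foot !=set0.
Proof. by case: Az => x Ax; exists (kpsi x); exists x. Qed.

Definition sub_chart : kchart R X :=
  KChart (smooth_vec_set_val (A0 := nonempty_of_zero) (@ksec_smooth _ _ K))
    sub_kpsi_embeds sub_kpsi_image sub_foot_open sub_foot_neq0.

End Subchart.

(** The index condition for bare linear maps, stated so that it can be transported along equalities
    of the differentials. *)
Definition index_at (R : realType) (V W E F : vectType R) (d : 'Hom(V, W))
    (s : 'Hom(V, E)) (t : 'Hom(W, F)) (h : 'Hom(E, F)) : Prop :=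
  (d @: lker s)%VS = lker t /\
  forall C, direct_sum (limg s) C -> direct_sum (limg t) (h @: C)%VS.

Lemma index_at_eq (R : realType) (V W E F : vectType R) (d d' : 'Hom(V, W))
    (s s' : 'Hom(V, E)) (t t' : 'Hom(W, F)) (h : 'Hom(E, F)) :
  d' = d -> s' = s -> t' = t -> index_at d s t h -> index_at d' s' t' h.
Proof. by move=> -> -> ->. Qed.

Section SubCoordChange.
Context {R : realType} {X : topologicalType} (K L : kchart R X).
Context (A : set (kdom K)) (B : set (kdom L)).
Hypotheses (oA : open A) (Az : A `&` @kzero _ _ K !=set0).
Hypotheses (oB : open B) (Bz : B `&` @kzero _ _ L !=set0).
Context (Phi : coord_change K L).

Let K' := sub_chart oA Az.
Let L' := sub_chart oB Bz.

Definition sub_cset : set (kdom K') := restr_dom B (cset Phi) (cphi Phi).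
Definition sub_cphi : kdom K' -> kdom L' :=
  restr_map (nonempty_of_zero Bz) (cphi Phi).

Lemma sub_cphiE (x : kdom K') : sub_cset x ->
  set_val (sub_cphi x : set_type B) = cphi Phi (set_val (x : set_type A)).
Proof. by move=> [_ Bx]; exact: restr_mapE. Qed.

Lemma cphi_cont : {within cset Phi, continuous (cphi Phi)}.
Proof. by have [[]] := cphi_embedding Phi. Qed.

Lemma sub_cset_open : open sub_cset.
Proof.
by apply: restr_dom_open => //; [exact: cset_open|exact: cphi_cont].
Qed.

Lemma sub_cset_zero : sub_cset `&` @kzero _ _ K' =
  @kzero _ _ K' `&` (@kpsi _ _ K') @^-1` (kfoot K' `&` kfoot L').
Proof.
have zeroE (x : kdom K') : @kzero _ _ K' x -> ksec (set_val (x : set_type A)) = 0.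
  by [].
apply/seteqP; split=> x.
  move=> [[cx Bx] x0]; split=> //; split.
    by exists (set_val x) => //; split=> //; exact: set_val_in.
  exists (cphi Phi (set_val x)); last exact: cpsi.
  by split=> //; rewrite /kzero /= csec // zeroE // linear0.
move=> [x0 [_ [y [By y0] yx]]]; split=> //.
have : (cset Phi `&` @kzero _ _ K) (set_val x).
  rewrite cset_zero; split=> //; split; rewrite -kpsi_image.
    by exists (set_val x).
  by exists y.
(* The zero [y] in [B] and the image of [x] have the same footprint point, so injectivity of [kpsi]
   identifies them and the image lies in [B]. *)
move=> [cx _]; split=> //=; suff <- : y = cphi Phi (set_val x) by [].
have [inj _ _] := kpsi_embeds L.
apply: inj; [exact/mem_set| |by rewrite yx cpsi].
by apply/mem_set; rewrite /= csec // zeroE // linear0.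
Qed.

Lemma sub_csec x : sub_cset x ->
  @ksec _ _ L' (sub_cphi x) = chat Phi (@ksec _ _ K' x).
Proof. by move=> cx; rewrite /= sub_cphiE // csec //; case: cx. Qed.

Lemma sub_cpsi x : sub_cset x -> @kzero _ _ K' x ->
  @kpsi _ _ L' (sub_cphi x) = @kpsi _ _ K' x.
Proof. by move=> cx x0; rewrite /= sub_cphiE // cpsi //; case: cx. Qed.

Lemma sub_cindex x : sub_cset x ->
  @index_condition _ _ K' L' sub_cphi (chat Phi) x.
Proof.
move=> cx _ _ [a Ma <-] ax [b Mb <-].
have -> : cdom (sub_coords oB (nonempty_of_zero Bz) b) (sub_cphi x) =
    cdom b (cphi Phi (set_val x)) by rewrite /= -sub_cphiE.
move=> bx; have cxE := sub_cphiE cx.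
have bx' : cdom b (set_val (sub_cphi x)) by rewrite cxE.
have dmapE := restr_dmap (oA := oA) (A0 := nonempty_of_zero Az) (oB := oB)
  (B0 := nonempty_of_zero Bz) b (@cset_open _ _ _ _ Phi) cphi_cont ax cx.
have KE := dvec_set_val oA (nonempty_of_zero Az) (@ksec _ _ K) ax.
have LE := etrans (dvec_set_val oB (nonempty_of_zero Bz) (@ksec _ _ L) bx')
  (congr1 (dvec (@ksec _ _ L) b) cxE).
exact: (index_at_eq dmapE KE LE (cindex cx.1 Ma ax Mb bx)).
Qed.

Definition sub_cc : coord_change K' L' :=
  CoordChange sub_cset_open sub_cset_zero
    (restr_smooth_embedding oA (nonempty_of_zero Az) oB (nonempty_of_zero Bz)
      (@cset_open _ _ _ _ Phi) (cphi_embedding Phi))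
    (@chat_inj _ _ _ _ Phi) sub_csec sub_cpsi sub_cindex.

End SubCoordChange.

Arguments sub_cphiE {R X K L A B oA Az oB Bz Phi} [x] _.

(** * Tame atlases and reductions *)

Section TameAtlas.
Context {R : realType} {X : topologicalType} {d : int} (K : atlas R X d).
Hypothesis tK : tame K.

Definition obj_at (I : idx K) (x : dom I) : obj K := existT _ I x.

(** When $J \subset L$, the first tameness identity reads $U_{IJ} \cap U_{IL} = U_{IL}$, so $U_{IL}
    \subset U_{IJ}$; the second one then puts $\phi_{IJ}(U_{IL})$ inside $U_{JL}$. *)
Lemma tame_factor (I J L : idx K) (hIJ : val I \subset val J)
    (hJL : val J \subset val L) (hIL : val I \subset val L) x :
  cset (cc hIL) x ->
  [/\ cset (cc hIJ) x, cset (cc hJL) (cphi (cc hIJ) x)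
    & cphi (cc hJL) (cphi (cc hIJ) x) = cphi (cc hIL) x].
Proof.
case: tK => _ tU tphi hx; have hIx : cset (cc hIJ) x.
  suff : (cset (cc hIJ) `&` cset (cc hIL)) x by move=> [].
  by rewrite tU; exists L, hIL; split=> //; apply/esym/finset.setUidPr.
have hJx : cset (cc hJL) (cphi (cc hIJ) x).
  have : (cphi (cc hIJ) @` cset (cc hIL)) (cphi (cc hIJ) x) by exists x.
  by rewrite (tphi _ _ _ hIJ hJL hIL) => -[].
by split=> //; exact: cc_cphi.
Qed.

(** An explicit form of the relation generated by morphisms: the two points become equal in a common
    later chart. *)
Definition joined (o o' : obj K) : Prop :=
  exists (L : idx K) (h : val (projT1 o) \subset val L)
    (h' : val (projT1 o') \subset val L),
    [/\ cset (cc h) (projT2 o), cset (cc h') (projT2 o')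
      & cphi (cc h) (projT2 o) = cphi (cc h') (projT2 o')].

Lemma joined_sym o o' : joined o o' -> joined o' o.
Proof. by move=> [L [h [h' [hx hy e]]]]; exists L, h', h; split. Qed.

Lemma joined_refl o : joined o o.
Proof.
by exists (projT1 o), (subxx _), (subxx _); split=> //; exact: id_cset.
Qed.

(** The middle point lies in $U_{JL} \cap U_{JN} = U_{J(L \cup N)}$, so a chart at $L \cup N$
    exists; its coordinate change from $J$ factors through both meeting charts and carries both
    coincidences into it. *)
Lemma joined_trans o o' o'' : joined o o' -> joined o' o'' -> joined o o''.
Proof.
case: o => I x; case: o' => J y; case: o'' => M z.
move=> [L [/= hIL [hJL [xL yL exy]]]] [N [/= hJN [hMN [yN zN eyz]]]].
case: (tK) => _ tU _.
have : @csetU _ _ _ K J (val L :|: val N)%SET y by rewrite -(tU _ _ _ hJL hJN).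
move=> [P [hJP [eP yP]]].
have hLP : val L \subset val P by rewrite eP finset.subsetUl.
have hNP : val N \subset val P by rewrite eP finset.subsetUr.
have hIP := fintype.subset_trans hIL hLP.
have hMP := fintype.subset_trans hMN hNP.
have [_ yLP eL] := tame_factor hJL hLP yP.
have [_ yNP eN] := tame_factor hJN hNP yP.
exists P, hIP, hMP => /=; split.
- by apply: (cc_cset (hIJ := hIL) (hJL := hLP)); split=> //=; rewrite exy.
- by apply: (cc_cset (hIJ := hMN) (hJL := hNP)); split=> //=; rewrite -eyz.
- rewrite -(cc_cphi (hJL := hLP) hIP xL) ?exy //.
  by rewrite -(cc_cphi (hJL := hNP) hMP zN) -?eyz // eL eN.
Qed.

Lemma joined_mor (m : mor K) : joined (msrc m) (mtgt m).
Proof.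
case: m => -[[I J] h] [x xin] /=; have hx := set_mem xin.
exists J, h, (subxx _); have [cT phi_id _] := cc_id (subxx (val J)).
by split=> //=; rewrite ?phi_id ?cT.
Qed.

Lemma piK_joined o o' : piK o = piK o' -> joined o o'.
Proof.
move=> /eqmodP /= /asboolP; elim=> {o o'}.
- by move=> _ _ [m [<- <-]]; exact: joined_mor.
- exact: joined_refl.
- by move=> o o' _; exact: joined_sym.
- by move=> o o' o'' _ oo' _; exact: joined_trans.
Qed.

(** The map into the common chart factors through [J], and injectivity of the last embedding cancels
    that chart. *)
Lemma joined_sub (I J : idx K) (h : val I \subset val J) (x : dom I) (y : dom J) :
  joined (obj_at x) (obj_at y) -> cset (cc h) x /\ cphi (cc h) x = y.
Proof.
move=> [L [hIL [hJL /= [xL yL e]]]]; have [xJ xJL eJ] := tame_factor h hJL xL.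
split=> //; have [_ [inj _ _] _] := cphi_embedding (cc hJL).
by apply: inj; [exact/mem_set|exact/mem_set|rewrite eJ].
Qed.

(** Zeros move forward by linearity of [chat] and backward by its injectivity. *)
Lemma joined_zobj o o' : joined o o' -> zobj o' -> zobj o /\ pobj o = pobj o'.
Proof.
case: o o' => [I x] [J y] [L [h [h' /= [xL yL e]]]]; rewrite /zobj /pobj /= => y0.
have x0 : kzero x.
  apply: (@chat_inj _ _ _ _ (cc h)); rewrite -csec // e csec // linear0.
  by rewrite [ksec y]y0 linear0.
by split=> //; rewrite -(cpsi xL x0) e cpsi.
Qed.

End TameAtlas.

(** * The hull of a reduction and its footprints *)

Section Hull.
Context {R : realType} {X : topologicalType} {d : int} (K : atlas R X d).
Context (V : set (obj K)).

(* The points carried into [V] by some coordinate change.  Shrinking the charts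
   to [hull], and not just to [V], makes footprints intersect as soon as the
   shrunk domains overlap in the realization, also away from the zero sets. *)
Definition hull (I : idx K) : set (dom I) :=
  [set x | exists (J : idx K) (h : val I \subset val J),
     cset (cc h) x /\ V (obj_at (cphi (cc h) x))].

Arguments hull I _ : clear implicits.

(** The footprint of the shrunk basic chart, read off from the zeros in [V] at all indices
    containing [i]; [hull_zero_image] justifies this description. *)
Definition hull_foot (i : basic K) : set X :=
  [set p | exists o : obj K, [/\ V o, zobj o, pobj o = p & i \in val (projT1 o)]].

Lemma hull_open : open V -> forall I, open (hull I).
Proof.
move=> /sigT_openP oV I.
have -> : hull I = \bigcup_(p in [set: {J : idx K | val I \subset val J}])
    (cset (cc (proj2_sig p)) `&`
     cphi (cc (proj2_sig p)) @^-1` [set y | V (obj_at y)]).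
  apply/seteqP; split=> x [p].
    by move=> [h hx]; exists (exist _ p h).
  by move=> _ hx; exists (proj1_sig p), (proj2_sig p).
apply: bigcup_open => p _; apply: open_within_preimage; last exact: oV.
  exact: cset_open.
exact: cphi_cont.
Qed.

Lemma sub_hull (I : idx K) (x : dom I) : V (obj_at x) -> hull I x.
Proof.
move=> Vx; exists I, (subxx _); have [-> -> _] := cc_id (subxx (val I)).
by split.
Qed.

(** Closure of the hull under going back along coordinate changes; the strong cocycle condition
    rests on it. *)
Lemma hull_cphi (I J : idx K) (h : val I \subset val J) (x : dom I) :
  cset (cc h) x -> hull J (cphi (cc h) x) -> hull I x.
Proof.
move=> hx [L [h' [h'x Vx]]]; have hIL := fintype.subset_trans h h'.
exists L, hIL; split; first by apply: (cc_cset (hJL := h')); split; first exact: hx.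
by rewrite -(cc_cphi hIL hx h'x).
Qed.

Lemma hull_foot_sub i : hull_foot i `<=` foot i.
Proof.
move=> p [[J y] [_ y0 <- iJ]]; have : kfoot (chart J) (kpsi y).
  by rewrite -kpsi_image; exists y.
by rewrite chart_foot; exact.
Qed.

End Hull.

Arguments hull [R X d K] V I _.

Section ReductionHull.
Context {R : realType} {X : topologicalType} {d : int} (K : atlas R X d).
Context (tK : tame K) (V : reduction K).

Lemma reduction_nested o o' : rset V o -> rset V o' -> piK o = piK o' ->
  val (projT1 o) \subset val (projT1 o') \/ val (projT1 o') \subset val (projT1 o).
Proof.
case: o o' => [I x] [J y] Vx Vy e; apply: (rset_nested (r := V)).
exists (piK (obj_at x)); split; first by exists x => //; exact: subset_closure.
by exists y => //; exact: subset_closure.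
Qed.

(** The covering condition only gives a point of [V] with the class of [p]; being joined to a zero
    over [p], it is itself a zero over [p]. *)
Lemma reduction_cover p : exists o : obj K, [/\ rset V o, zobj o & pobj o = p].
Proof.
have [q Vq e] : (@piK _ _ _ K @` V) (iotaK K p) by apply: rset_iota; exists p.
have [r [r0 rp]] := ex_zobj K p.
rewrite -rp iotaK_pobj // in e.
by have [q0 qr] := joined_zobj (piK_joined tK e) r0; exists q; rewrite -rp -qr.
Qed.

(* By nestedness the indices of the points of [V] over [p] form a chain. *)
Lemma hull_footI (I : {set basic K}) p :
  I != finset.set0 -> footI (hull_foot V) I p ->
  exists o : obj K, [/\ rset V o, zobj o, pobj o = p & I \subset val (projT1 o)].
Proof.
move=> /finset.set0Pn[i iI] Ip.
pose P (J : idx K) :=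
  `[< exists y : dom J, [/\ rset V (obj_at y), kzero y & kpsi y = p] >].
have [[J0 y0] [Vy0 zy0 ey0 _]] := Ip i iI.
have PJ0 : P J0 by apply/asboolP; exists y0.
(* Take an index of maximal cardinality among those of points of [V] over [p]. Any other such index
   is comparable with it, hence contained in it. *)
case: (arg_maxnP (fun J : idx K => #|val J|) PJ0) => J /asboolP[y [Vy zy ey]] maxJ.
exists (obj_at y); split=> //; apply/fintype.subsetP => j jI /=.
have [[L z] [Vz zz ez jL]] := Ip j jI.
have PL : P L by apply/asboolP; exists z.
have e : piK (obj_at y) = piK (obj_at z).
  by rewrite -!iotaK_pobj // /pobj /= ey; congr (iotaK K _); rewrite -ez.
have [/= JL|/= LJ] := reduction_nested Vy Vz e; last exact: (fintype.subsetP LJ).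
suff -> : val J = val L by [].
by apply/eqP; rewrite finset.eqEcard JL /=; exact: maxJ.
Qed.

(** A zero in the hull is pushed into [V] over the same point. Conversely [hull_footI] gives a zero
    of [V] over [p] at some $J \supset I$; the zero of chart [I] over [p] is mapped to it because
    the footprint map of [J] is injective. *)
Lemma hull_zero_image (I : idx K) :
  sub_foot (hull V I) = footI (hull_foot V) (val I).
Proof.
apply/seteqP; split=> [_ [x [[J [h [hx Vx]]] x0] <-] i iI|p Ip].
  exists (obj_at (cphi (cc h) x)); split=> //; last exact: (fintype.subsetP h).
    by rewrite /zobj /kzero /= csec // [ksec x]x0 linear0.
  exact: cpsi.
have /andP[I0 _] := valP I.
have [[J y] [Vy y0 yp IJ]] := hull_footI I0 Ip; rewrite /zobj /pobj /= in y0 yp IJ.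
have Jp : kfoot (chart J) p by rewrite -kpsi_image; exists y.
have Ifp : kfoot (chart I) p.
  by rewrite chart_foot => i /Ip /hull_foot_sub.
have [x x0 xp] : (@kpsi _ _ (chart I) @` @kzero _ _ (chart I)) p by rewrite kpsi_image.
have [hx _] : (cset (cc IJ) `&` @kzero _ _ (chart I)) x.
  by rewrite cset_zero; split=> //; rewrite /= xp.
exists x => //; split=> //; exists J, IJ; split=> //.
suff -> : cphi (cc IJ) x = y by [].
have [inj _ _] := kpsi_embeds (chart J).
apply: inj; [|exact/mem_set|by rewrite cpsi // xp].
by apply/mem_set; rewrite /= csec // [ksec x]x0 linear0.
Qed.

End ReductionHull.

(** * The reduced atlas *)

Section ReducedAtlas.
Context {R : realType} {X : topologicalType} {d : int} (K : atlas R X d).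
Context (tK : tame K) (V : reduction K).

(** Charts must have nonempty footprints, so basic indices whose footprint shrinks to nothing are
    discarded; [ridx] translates the new indices into old ones. *)
Definition rbasic : finType := {i : basic K | `[< hull_foot V i !=set0 >]}.

Definition rfoot (i : rbasic) : set X := hull_foot V (val i).

Lemma rfoot_neq0 i : rfoot i !=set0.
Proof. exact: asboolW (valP i). Qed.

Lemma rfoot_cover p : exists i, rfoot i p.
Proof.
have [[I x] [Vx x0 xp]] := reduction_cover tK V p.
have /andP[/finset.set0Pn[i iI] _] := valP I.
have ip : hull_foot V i p by exists (obj_at x).
have i0 : `[< hull_foot V i !=set0 >] by apply/asboolP; exists p.
by exists (exist _ i i0).
Qed.

Definition ridx_set (C : {set rbasic}) : {set basic K} := [set val i | i in C]%SET.

Lemma footI_ridx_set (C : {set rbasic}) :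
  footI (hull_foot V) (ridx_set C) = footI rfoot C.
Proof.
apply/seteqP; split=> p Cp i iC; first by apply: Cp; exact: imset_f.
by have [j jC ->] := imsetP iC; exact: Cp.
Qed.

Lemma ridx_set_nerve (C : nerve rfoot) : in_nerve (@foot _ _ _ K) (ridx_set (val C)).
Proof.
have /andP[/finset.set0Pn[i iC] /asboolP[p]] := valP C.
rewrite -footI_ridx_set => Cp; apply/andP; split.
  by apply/finset.set0Pn; exists (val i); exact: imset_f.
by apply/asboolP; exists p => j /Cp /hull_foot_sub.
Qed.

Definition ridx (C : nerve rfoot) : idx K :=
  exist (fun I => in_nerve (@foot _ _ _ K) I) _ (ridx_set_nerve C).

Lemma ridx_sub (C D : nerve rfoot) :
  val C \subset val D -> val (ridx C) \subset val (ridx D).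
Proof. exact: imsetS. Qed.

Lemma ridx_foot (C : nerve rfoot) :
  sub_foot (hull V (ridx C)) = footI rfoot (val C).
Proof. by rewrite hull_zero_image footI_ridx_set. Qed.

Lemma ridx_zero (C : nerve rfoot) :
  hull V (ridx C) `&` @kzero _ _ (chart (ridx C)) !=set0.
Proof.
have /andP[_ /asboolP[p]] := valP C.
by rewrite -ridx_foot => -[x x0 _]; exists x.
Qed.

Definition rhull_open (C : nerve rfoot) : open (hull V (ridx C)) :=
  hull_open (@rset_open _ _ _ _ V) (ridx C).

Definition rchart (C : nerve rfoot) : kchart R X :=
  sub_chart (rhull_open C) (ridx_zero C).

Definition rcc (C D : nerve rfoot) (h : val C \subset val D) :
  coord_change (rchart C) (rchart D) :=
  sub_cc (rhull_open C) (ridx_zero C) (rhull_open D) (ridx_zero D)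
    (cc (ridx_sub h)).

Lemma rcphiE (C D : nerve rfoot) (h : val C \subset val D)
    (x : kdom (rchart C)) : cset (rcc h) x ->
  set_val (cphi (rcc h) x : set_type (hull V (ridx D))) =
  cphi (cc (ridx_sub h)) (set_val (x : set_type (hull V (ridx C)))).
Proof.
by move=> cx; apply: (sub_cphiE (oA := rhull_open C) (oB := rhull_open D) cx).
Qed.

Lemma rcc_id (C : nerve rfoot) (h : val C \subset val C) :
  [/\ cset (rcc h) = setT, cphi (rcc h) =1 id & chat (rcc h) =1 id].
Proof.
have [cT phi_id chat_id] := cc_id (ridx_sub h).
have hx (x : kdom (rchart C)) :
    hull V (ridx C) (cphi (cc (ridx_sub h)) (set_val x)).
  by rewrite phi_id; exact: set_val_in.
have cx (x : kdom (rchart C)) : cset (rcc h) x.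
  by split; [rewrite cT|exact: hx].
split=> // [|x]; first by apply/seteqP; split=> // x _; exact: cx.
by apply: set_val_inj; rewrite (rcphiE (cx x)); exact: phi_id.
Qed.

Lemma rcc_cset (C D E : nerve rfoot) (hCD : val C \subset val D)
    (hDE : val D \subset val E) (hCE : val C \subset val E) :
  cset (rcc hCD) `&` cphi (rcc hCD) @^-1` cset (rcc hDE) `<=` cset (rcc hCE).
Proof.
move=> x [cx [dx Ex]]; have xE := rcphiE cx; rewrite xE in dx; rewrite /= xE in Ex.
split; last by rewrite /= -(cc_cphi (ridx_sub hCE) cx.1 dx).
have := @cc_cset _ _ _ K _ _ _ (ridx_sub hCD) (ridx_sub hDE) (ridx_sub hCE).
by apply; split=> //; exact: cx.1.
Qed.

Lemma rcc_cphi (C D E : nerve rfoot) (hCD : val C \subset val D)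
    (hDE : val D \subset val E) (hCE : val C \subset val E) x :
  cset (rcc hCD) x -> cset (rcc hDE) (cphi (rcc hCD) x) ->
  cphi (rcc hDE) (cphi (rcc hCD) x) = cphi (rcc hCE) x.
Proof.
move=> cx dx; have ex : cset (rcc hCE) x by exact: rcc_cset (conj cx dx).
apply: set_val_inj; rewrite (rcphiE dx) (rcphiE cx) (rcphiE ex).
by apply: cc_cphi; [exact: cx.1|have := dx.1; rewrite /= rcphiE].
Qed.

Definition reduced_atlas : atlas R X d :=
  @Atlas _ _ _ rbasic rfoot rfoot_neq0 rfoot_cover rchart ridx_foot
    (fun C => chart_dim (ridx C)) rcc rcc_id
    (fun C D E hCD hDE hCE =>
       cc_hat (ridx_sub hCD) (ridx_sub hDE) (ridx_sub hCE))
    rcc_cset rcc_cphi.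

Lemma reduced_strong_cocycle : strong_cocycle reduced_atlas.
Proof.
move=> C D E hCD hDE hCE; apply/seteqP; split; first exact: rcc_cset.
move=> x [xE Ex]; have [xD xDE eDE] := tame_factor tK (ridx_sub hCD) (ridx_sub hDE) xE.
(* The image of [x] in chart [D] lies in the hull because its further image in chart [E] does. *)
have cx : cset (rcc hCD) x.
  split=> //; apply: (hull_cphi (h := ridx_sub hDE)) => //.
  by rewrite eDE.
split=> //; split; rewrite /= (rcphiE cx) //.
by rewrite eDE.
Qed.

End ReducedAtlas.

(** * The inclusion functor and the induced map of realizations *)

Section ReductionFunctor.
Context {R : realType} {X : topologicalType} {d : int} (K : atlas R X d).
Context (tK : tame K) (V : reduction K).

Let KV := reduced_atlas tK V.

Definition rincl_at (C : idx KV) (x : dom C) : obj K :=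
  obj_at (set_val (x : set_type (hull V (ridx C)))).

Definition rincl_obj : obj KV -> obj K := fun o => rincl_at (projT2 o).

Lemma rincl_obj_continuous : continuous rincl_obj.
Proof.
apply: sigT_continuous => C x; apply: (@continuous_comp _ _ _ set_val).
  exact: set_val_continuous.
exact: existT_continuous.
Qed.

Lemma rincl_cset (p : arrow KV) (x : set_type (cset (cc (proj2_sig p)))) :
  cset (cc (ridx_sub (proj2_sig p)))
    (set_val (set_val x : set_type (hull V (ridx (proj1_sig p).1)))).
Proof. by have [] := set_val_in x. Qed.

Definition rincl_mor_at (p : arrow KV) (x : set_type (cset (cc (proj2_sig p)))) :
  mor K := mk_mor (rincl_cset x).

Definition rincl_mor : mor KV -> mor K := fun m => rincl_mor_at (projT2 m).

Lemma rincl_mor_continuous : continuous rincl_mor.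
Proof.
apply: sigT_continuous => p.
pose B := cset (cc (ridx_sub (proj2_sig p))).
(* On each summand the map factors as an inclusion of subspaces followed by the inclusion of a
   summand of the target. *)
pose g (x : set_type (cset (cc (proj2_sig p)))) : set_type B :=
  exist _ (set_val (set_val x : set_type (hull V (ridx (proj1_sig p).1))))
    (mem_set (rincl_cset x)).
have cg : continuous g.
  apply/set_type_continuousP => x.
  exact: (continuous_comp (@set_val_continuous _ _ x)
    (@set_val_continuous _ (hull V (ridx (proj1_sig p).1)) (set_val x))).
move=> x; apply: (@continuous_comp _ _ _ g); first exact: cg.
exact: (@existT_continuous _ _
  (exist (fun p : idx K * idx K => val p.1 \subset val p.2)
    (ridx (proj1_sig p).1, ridx (proj1_sig p).2) (ridx_sub (proj2_sig p)))).
Qed.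

Lemma rincl_src m : msrc (rincl_mor m) = rincl_obj (msrc m).
Proof. by case: m => -[[C D] h] x. Qed.

Lemma rincl_tgt m : mtgt (rincl_mor m) = rincl_obj (mtgt m).
Proof.
case: m => -[[C D] h] x; rewrite /mtgt /rincl_obj /rincl_at /obj_at /=.
by congr existT; symmetry; exact: (rcphiE (h := h) (set_val_in x)).
Qed.

Lemma rincl_id o : rincl_mor (mid o) = mid (rincl_obj o).
Proof. by apply: mor_thin; rewrite ?rincl_src ?rincl_tgt ?msrc_id ?mtgt_id. Qed.

Lemma rincl_comp (m n : mor KV) (e : mtgt m = msrc n)
    (e' : mtgt (rincl_mor m) = msrc (rincl_mor n)) :
  rincl_mor (mcomp e) = mcomp e'.
Proof.
by apply: mor_thin; rewrite ?rincl_src ?rincl_tgt ?msrc_comp ?mtgt_comp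
  ?rincl_src ?rincl_tgt.
Qed.

Definition rincl : bfunctor KV K :=
  BFunctor rincl_obj_continuous rincl_mor_continuous rincl_src rincl_tgt rincl_id
    rincl_comp.

Lemma rincl_faithful : faithful rincl.
Proof. by move=> m n es et _; exact: mor_thin. Qed.

Lemma piK_rincl o o' : piK o = piK o' -> piK (rincl o) = piK (rincl o').
Proof.
move=> /eqmodP /= /asboolP; elim=> {o o'} //.
- by move=> _ _ [m [<- <-]]; rewrite /= -rincl_src -rincl_tgt; exact: piK_mor.
- by move=> o o' o'' _ -> _ ->.
Qed.

Lemma ridx_sub_inj (C D : idx KV) :
  val (ridx C) \subset val (ridx D) -> val C \subset val D.
Proof.
move=> CD; apply/fintype.subsetP => i iC.
have : val i \in val (ridx D) by apply: (fintype.subsetP CD); exact: imset_f.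
by rewrite /= (mem_imset _ _ val_inj).
Qed.

(** A nonempty $V_J$ contains a zero [z]; its footprint point lies in every new footprint indexed by
    [J], so [J] survives in the new nerve. *)
Lemma ridx_surj (J : idx K) (y : dom J) :
  rset V (obj_at y) -> exists D : idx KV, ridx D = J.
Proof.
move=> Vy; have [|z [Vz z0]] := rset_zero (r := V) (I := J); first by exists y.
have Jz i : i \in val J -> hull_foot V i (kpsi z) by move=> iJ; exists (obj_at z).
pose D : {set rbasic V} := [set i | val i \in val J]%SET.
have DJ : ridx_set D = val J.
  apply/setP => i; apply/imsetP/idP => [[j + ->]|iJ]; first by rewrite finset.inE.
  have i0 : `[< hull_foot V i !=set0 >] by apply/asboolP; exists (kpsi z); exact: Jz.
  by exists (exist _ i i0) => //; rewrite finset.inE.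
have nD : in_nerve (@rfoot _ _ _ K V) D.
  apply/andP; split; last first.
    by apply/asboolP; exists (kpsi z) => i; rewrite finset.inE; exact: Jz.
  have /andP[/finset.set0Pn[i]] := valP J.
  by rewrite -DJ => /imsetP[j jD _] _; apply/finset.set0Pn; exists j.
by exists (exist _ D nD); exact: val_inj.
Qed.

(** A coordinate change of [K] between two hull points is already a morphism of the reduced
    category. *)
Lemma piK_rincl_step (C D : idx KV) (x : dom C) (y : dom D)
    (h : val (ridx C) \subset val (ridx D)) :
  cset (cc h) (set_val (x : set_type (hull V (ridx C)))) ->
  cphi (cc h) (set_val (x : set_type (hull V (ridx C)))) =
    set_val (y : set_type (hull V (ridx D))) ->
  piK (obj_at x) = piK (obj_at y).
Proof.
move=> hx xy; have hCD := ridx_sub_inj h.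
have eh : h = ridx_sub hCD by exact: bool_irrelevance.
rewrite {}eh in hx xy.
have cx : cset (rcc hCD) x by split=> //=; rewrite xy; exact: set_val_in.
rewrite [LHS](@piK_mor _ _ _ KV (@mk_mor _ _ _ KV C D hCD x cx)); congr piK.
congr existT; apply: set_val_inj; rewrite -xy; exact: rcphiE.
Qed.

(** Membership in the hull supplies a coordinate change into [V], and [ridx_surj] makes its target
    chart a chart of the reduced atlas. *)
Lemma rincl_reduce (o : obj KV) : exists2 o' : obj KV,
  rset V (rincl o') & piK o = piK o'.
Proof.
case: o => C x; have [J [h [hx Vx]]] := set_val_in x.
have [D DJ] := ridx_surj Vx; case: J / DJ in h hx Vx *.
have [y yx] := ex_set_type (sub_hull Vx).
exists (existT _ D y); first by rewrite /= /rincl_obj /rincl_at /= yx.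
exact: (piK_rincl_step (h := h)).
Qed.

Lemma piK_rincl_inj o o' : piK (rincl o) = piK (rincl o') -> piK o = piK o'.
Proof.
have [r Vr er] := rincl_reduce o; have [r' Vr' er'] := rincl_reduce o'.
rewrite (piK_rincl er) (piK_rincl er') er er' => e.
have jrr' := piK_joined tK e.
case: r r' Vr Vr' {er er'} e jrr' => [C x] [D y] Vr Vr' e jrr'.
(* Both representatives now lie in [V], so their indices are nested and [joined_sub] yields a single
   coordinate change between them. *)
have [CD|DC] : val (ridx C) \subset val (ridx D) \/
    val (ridx D) \subset val (ridx C) := reduction_nested Vr Vr' e.
  have [hx xy] := joined_sub tK CD jrr'; exact: (piK_rincl_step (h := CD)).
have [hy yx] := joined_sub tK DC (joined_sym jrr').
by apply: esym; exact: (piK_rincl_step (h := DC)).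
Qed.

Lemma rincl_realization : exists f : realization KV -> realization K,
  [/\ forall o : obj KV, f (piK o) = piK (rincl o),
      continuous f, injective f & range f = @piK _ _ _ K @` V].
Proof.
pose f (q : realization KV) : realization K := piK (rincl (repr q)).
have fE o : f (piK o) = piK (rincl o).
  by apply: piK_rincl; rewrite /piK reprK.
have surj (q : realization KV) : exists o, q = piK o.
  by exists (repr q); rewrite /piK reprK.
exists f; split=> //.
- apply/quotient_continuous.
  have -> : f \o \pi_(realization KV)%qT = @piK _ _ _ K \o rincl.
    by apply/funext => o; exact: fE.
  move=> o; apply: continuous_comp; first exact: rincl_obj_continuous.
  exact: pi_continuous.
- move=> q q'; have [u ->] := surj q; have [u' ->] := surj q'.
  by rewrite !fE; exact: piK_rincl_inj.
(* Every class has a representative in [V] by [rincl_reduce]; conversely each point of [V] lies in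
   the hull of a surviving chart. *)
- apply/seteqP; split=> [_ [q _ <-]|_ [[I x] Vx <-]].
    have [u ->] := surj q; rewrite fE; have [u' Vu' e] := rincl_reduce u.
    by exists (rincl u') => //; symmetry; exact: piK_rincl.
  have [C CI] := ridx_surj Vx; case: I / CI in x Vx *.
  have [y yx] := ex_set_type (sub_hull Vx).
  by exists (piK (existT _ C y)) => //; rewrite fE /= /rincl_obj /rincl_at /= yx.
Qed.

End ReductionFunctor.

(** * Naturality *)

Section IsoTransport.
Context {R : realType} {X : topologicalType} {d : int} (K K' : atlas R X d).
Context (g : atlas_iso K K').

Lemma iso_basic_inj : injective (iso_basic g).
Proof. exact: bij_inj (iso_basic_bij g). Qed.

(** Pull the index set back by the inverse bijection; as footprints are preserved, the intersection
    stays nonempty. *)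
Lemma iso_idx_surj (J' : idx K') : exists J, iso_idx g J = J'.
Proof.
have [b bK Kb] := iso_basic_bij g.
have bJ : [set iso_basic g i | i in [set b i | i in val J']]%SET = val J'.
  by rewrite -imset_comp (eq_imset _ Kb) imset_id.
have /andP[/finset.set0Pn[i iJ] /asboolP[p Jp]] := valP J'.
have nJ : in_nerve (@foot _ _ _ K) [set b i | i in val J']%SET.
  apply/andP; split; first by apply/finset.set0Pn; exists (b i); exact: imset_f.
  apply/asboolP; exists p => j /imsetP[k kJ ->].
  by rewrite -(iso_foot g) Kb; exact: Jp.
exists (exist (fun I => in_nerve (@foot _ _ _ K) I) _ nJ).
by apply: val_inj; rewrite iso_idxE.
Qed.

Lemma iso_idx_sub (I J : idx K) :
  (val (iso_idx g I) \subset val (iso_idx g J)) = (val I \subset val J).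
Proof.
rewrite !iso_idxE; apply/idP/idP => [IJ|]; last exact: imsetS.
apply/fintype.subsetP => i iI; rewrite -(mem_imset _ _ iso_basic_inj).
by apply: (fintype.subsetP IJ); exact: imset_f.
Qed.

Lemma iso_dom_surj (I : idx K) (y : dom (iso_idx g I)) :
  exists x, iso_dom g x = y.
Proof. by have [_ [f [_ _ fK]]] := iso_dom_diffeo g I; exists (f y). Qed.

Lemma iso_kzero (I : idx K) (x : dom I) : kzero (iso_dom g x) <-> kzero x.
Proof.
rewrite /kzero /= iso_sec; split=> [e|->]; last exact: linear0.
by apply: (bij_inj (iso_obs_bij g I)); rewrite e linear0.
Qed.

(* [iso_idx g (ridx C)] and [ridx] of the transported index agree only
   propositionally: the data of [g] are cast along such an equality. *)
Definition iso_dom_at (I : idx K) (I' : idx K') (e : iso_idx g I = I') :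
    dom I -> dom I' :=
  match e in _ = J return dom I -> dom J with erefl => @iso_dom _ _ _ _ _ g I end.

Definition iso_obs_at (I : idx K) (I' : idx K') (e : iso_idx g I = I') :
    'Hom(obs I, obs I') :=
  match e in _ = J return 'Hom(obs I, obs J) with erefl => iso_obs g I end.

Lemma iso_dom_at_diffeo I I' (e : iso_idx g I = I') : diffeo (iso_dom_at e).
Proof. by case: I' / e; exact: iso_dom_diffeo. Qed.

Lemma iso_obs_at_bij I I' (e : iso_idx g I = I') : bijective (iso_obs_at e).
Proof. by case: I' / e; exact: iso_obs_bij. Qed.

Lemma iso_sec_at I I' (e : iso_idx g I = I') (x : dom I) :
  ksec (iso_dom_at e x) = iso_obs_at e (ksec x).
Proof. by case: I' / e; exact: iso_sec. Qed.

Lemma iso_psi_at I I' (e : iso_idx g I = I') (x : dom I) :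
  kzero x -> kpsi (iso_dom_at e x) = kpsi x.
Proof. by case: I' / e; exact: iso_psi. Qed.

Lemma iso_obj_at I I' (e : iso_idx g I = I') (x : dom I) :
  obj_at (iso_dom_at e x) = iso_obj g (obj_at x).
Proof. by case: I' / e. Qed.

Section Changes.
Context (I J : idx K) (I' J' : idx K').
Context (eI : iso_idx g I = I') (eJ : iso_idx g J = J').
Context (h : val I \subset val J) (h' : val I' \subset val J').

Lemma iso_cset_at x : cset (cc h') (iso_dom_at eI x) <-> cset (cc h) x.
Proof. by case: I' / eI h'; case: J' / eJ => h'' /=; exact: iso_cset. Qed.

Lemma iso_cphi_at x : cset (cc h) x ->
  cphi (cc h') (iso_dom_at eI x) = iso_dom_at eJ (cphi (cc h) x).
Proof. by case: I' / eI h'; case: J' / eJ => h'' /=; exact: iso_cphi. Qed.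

Lemma iso_chat_at e :
  chat (cc h') (iso_obs_at eI e) = iso_obs_at eJ (chat (cc h) e).
Proof. by case: I' / eI h'; case: J' / eJ => h'' /=; exact: iso_chat. Qed.

End Changes.

Context (V : set (obj K)) (V' : set (obj K')).
Hypothesis VV' : forall o : obj K, V' (iso_obj g o) <-> V o.

Lemma iso_hull_at I I' (e : iso_idx g I = I') (x : dom I) :
  hull V' I' (iso_dom_at e x) <-> hull V I x.
Proof.
split=> [[J' [h' [hx V'x]]]|[J [h [hx Vx]]]].
  (* The target chart is an arbitrary chart of [K']; it must first be recognised as the image of a
     chart of [K]. *)
  have [J eJ] := iso_idx_surj J'.
  have h : val I \subset val J by rewrite -iso_idx_sub e eJ.
  have hx' := (iso_cset_at e eJ h h' x).1 hx.
  exists J, h; split=> //; apply/VV'.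
  by rewrite -(iso_obj_at eJ) -(iso_cphi_at e eJ h').
have h' : val I' \subset val (iso_idx g J) by rewrite -e iso_idx_sub.
exists (iso_idx g J), h'; split; first exact/(iso_cset_at e erefl h h').
by rewrite (iso_cphi_at e erefl h') // iso_obj_at; apply/VV'.
Qed.

Lemma iso_hull_foot i : hull_foot V' (iso_basic g i) = hull_foot V i.
Proof.
apply/seteqP; split=> [p [[J' y] [Vy y0 yp iJ]]|p [[J x] [Vx x0 xp iJ]]].
  have [J eJ] := iso_idx_surj J'; case: J' / eJ in y Vy y0 yp iJ *.
  have [x xy] := iso_dom_surj y; rewrite -{}xy in Vy y0 yp iJ.
  have x0 : kzero x by apply/iso_kzero.
  exists (obj_at x); split=> //; first exact/VV'.
    by rewrite -yp /pobj /= iso_psi.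
  by move: iJ; rewrite /= iso_idxE (mem_imset _ _ iso_basic_inj).
exists (obj_at (iso_dom g x)); split; first exact: (VV' (obj_at x)).2 Vx.
- exact/iso_kzero.
- by rewrite -xp /pobj /= iso_psi.
- by rewrite /= iso_idxE imset_f.
Qed.

End IsoTransport.

Section Naturality.
Context {R : realType} {X : topologicalType} {d : int} (K K' : atlas R X d).
Context (tK : tame K) (tK' : tame K') (V : reduction K) (V' : reduction K').
Context (g : atlas_iso K K').
Hypothesis VV' : forall o : obj K, rset V' (iso_obj g o) <-> rset V o.

Let KV := reduced_atlas tK V.
Let KV' := reduced_atlas tK' V'.

Lemma riso_basic_proof (i : rbasic V) :
  `[< hull_foot V' (iso_basic g (val i)) !=set0 >].
Proof. by rewrite (iso_hull_foot VV'); exact: valP i. Qed.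

Definition riso_basic (i : basic KV) : basic KV' :=
  exist (fun i => `[< hull_foot V' i !=set0 >]) _ (riso_basic_proof i).

Lemma riso_basic_bij : bijective riso_basic.
Proof.
have [b bK Kb] := iso_basic_bij g.
have pb (i : rbasic V') : `[< hull_foot V (b (val i)) !=set0 >].
  by rewrite -(iso_hull_foot VV') Kb; exact: valP i.
exists (fun i => exist (fun i => `[< hull_foot V i !=set0 >]) _ (pb i)) => i;
  by apply: val_inj; rewrite /= ?bK ?Kb.
Qed.

Lemma riso_foot (i : basic KV) : foot (riso_basic i) = foot i.
Proof. exact: iso_hull_foot. Qed.

Lemma riso_idx_proof (C : idx KV) :
  in_nerve (@rfoot _ _ _ K' V') [set riso_basic i | i in val C]%SET.
Proof.
have /andP[/finset.set0Pn[i iC] /asboolP[p Cp]] := valP C.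
apply/andP; split; first by apply/finset.set0Pn; exists (riso_basic i); exact: imset_f.
by apply/asboolP; exists p => _ /imsetP[j jC ->]; rewrite [rfoot _]riso_foot; exact: Cp.
Qed.

Definition riso_idx (C : idx KV) : idx KV' :=
  exist (fun C => in_nerve (@rfoot _ _ _ K' V') C) _ (riso_idx_proof C).

Lemma iso_ridx (C : idx KV) : iso_idx g (ridx C) = ridx (riso_idx C).
Proof. by apply: val_inj; rewrite iso_idxE /= /ridx_set -!imset_comp. Qed.

Definition riso_dom (C : idx KV) : dom C -> dom (riso_idx C) :=
  restr_map (nonempty_of_zero (ridx_zero (riso_idx C))) (iso_dom_at (iso_ridx C)).

(** The isomorphism carries hull to hull, so the retraction in [riso_dom] never returns its
    default. *)
Lemma riso_domE (C : idx KV) (x : dom C) :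
  set_val (riso_dom x : set_type (hull V' (ridx (riso_idx C)))) =
  iso_dom_at (iso_ridx C) (set_val (x : set_type (hull V (ridx C)))).
Proof. by apply: restr_mapE; apply/(iso_hull_at VV'); exact: set_val_in. Qed.

Lemma riso_dom_diffeo (C : idx KV) : diffeo (@riso_dom C).
Proof.
apply: restr_diffeo; last exact: iso_dom_at_diffeo.
by move=> x; exact: iso_hull_at.
Qed.

Lemma riso_sec (C : idx KV) (x : dom C) :
  ksec (riso_dom x) = iso_obs_at (iso_ridx C) (ksec x).
Proof. by rewrite /= riso_domE; exact: iso_sec_at. Qed.

Lemma riso_psi (C : idx KV) (x : dom C) :
  kzero x -> kpsi (riso_dom x) = kpsi x.
Proof. by move=> x0; rewrite /= riso_domE; exact: iso_psi_at. Qed.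

Lemma riso_cset (C D : idx KV) (h : val C \subset val D)
    (h' : val (riso_idx C) \subset val (riso_idx D)) x :
  cset (cc h') (riso_dom x) <-> cset (cc h) x.
Proof.
have csetE := iso_cset_at (iso_ridx C) (iso_ridx D) (ridx_sub h) (ridx_sub h').
have cphiE := @iso_cphi_at _ _ _ _ _ g _ _ _ _ (iso_ridx C) (iso_ridx D)
  (ridx_sub h) (ridx_sub h').
rewrite /= /sub_cset /restr_dom /= riso_domE; split=> -[cx hx]; split.
- exact/csetE.
- by move: hx; rewrite /= cphiE; [move=> /(iso_hull_at VV')|exact/csetE].
- exact/csetE.
- by rewrite /= cphiE //; apply/(iso_hull_at VV').
Qed.

Lemma riso_cphi (C D : idx KV) (h : val C \subset val D)
    (h' : val (riso_idx C) \subset val (riso_idx D)) x :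
  cset (cc h) x -> cphi (cc h') (riso_dom x) = riso_dom (cphi (cc h) x).
Proof.
move=> cx; have c'x := (riso_cset h h' x).2 cx.
apply: set_val_inj; rewrite (rcphiE c'x) !riso_domE (rcphiE cx).
by apply: iso_cphi_at; case: cx.
Qed.

(** Obstruction spaces are not shrunk: the linear parts are those of [g], cast along [iso_ridx]. *)
Definition riso : atlas_iso KV KV' :=
  @AtlasIso _ _ _ KV KV' riso_basic riso_idx riso_dom
    (fun C => iso_obs_at (iso_ridx C)) riso_basic_bij riso_foot (fun=> erefl)
    riso_dom_diffeo (fun C => iso_obs_at_bij (iso_ridx C)) riso_sec riso_psi
    riso_cset riso_cphi
    (fun C D h h' => iso_chat_at (iso_ridx C) (iso_ridx D) (ridx_sub h) (ridx_sub h')).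

Lemma rincl_iso (o : obj KV) :
  rincl tK' V' (iso_obj riso o) = iso_obj g (rincl tK V o).
Proof.
case: o => C x; rewrite /= /rincl_obj /= /rincl_at /= riso_domE.
exact: iso_obj_at.
Qed.

End Naturality.

Theorem proposition7p1p7 (R : realType) (X : topologicalType) (d : int)
    (cX : compact [set: X]) (mX : metrizable R X) :
  exists (red : forall K : atlas R X d, tame K -> reduction K -> atlas R X d)
         (incl : forall (K : atlas R X d) (tK : tame K) (V : reduction K),
                   bfunctor (red K tK V) K),
    (forall (K : atlas R X d) (tK : tame K) (V : reduction K),
       [/\ strong_cocycle (red K tK V),
           faithful (incl K tK V)
         & exists f : realization (red K tK V) -> realization K,
             [/\ forall o : obj (red K tK V), f (piK o) = piK (incl K tK V o),
                 continuous f,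
                 injective f
               & range f = @piK _ _ _ K @` V]])
    /\ natural_reduction incl.
Proof.
exists (@reduced_atlas R X d), (@rincl R X d); split=> [K tK V|].
  split; [exact: reduced_strong_cocycle|exact: rincl_faithful|].
  exact: rincl_realization.
move=> K K' tK tK' V V' g VV'; exists (riso tK tK' VV') => o.
exact: rincl_iso.
Qed.
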